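(* Let $k$ be a field of prime characteristic $p$, let $C\subset\mathbb{P}^2_k$ be a nodal cubic curve given by the homogeneous cubic equation $f\in S=k[x,y,z]$, and let $q$ be a power of $p$. Then the Hilbert-Kunz function $HK_C(q)=\dim_k S/(f,x^q,y^q,z^q)$ of $C$ at $q$ is $$HK_C(q)=\begin{cases}\frac{7}{3}q^2-\frac{1}{3}q-1 & \text{if } q\not\equiv 2 \bmod 3,\\[2pt] \frac{7}{3}q^2-\frac{1}{3}q-\frac{5}{3} & \text{if } q\equiv 2\bmod 3.\end{cases}$$
   Context: A nodal cubic is a plane cubic curve which, over an algebraic closure of $k$, is irreducible and has a unique singular point that is a node, i.e. the tangent cone at that point consists of two distinct lines. The Hilbert-Kunz function is invariant under extension of the field $k$, and at powers $q$ of the characteristic it does not depend on the choice of linear coordinates $x,y,z$. *)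

(* Defs.v *)
From HB Require Import structures.
From mathcomp Require Import all_boot all_order all_algebra.
From mathcomp Require Import mpoly.

Set Implicit Arguments.
Unset Strict Implicit.
Unset Printing Implicit Defensive.

Import GRing.Theory.
Local Open Scope ring_scope.

Definition irreducible_elt (R : idomainType) (r : R) : Prop :=
  [/\ r != 0, r \isn't a GRing.unit &
      forall a b : R, r = a * b -> a \is a GRing.unit \/ b \is a GRing.unit].

(* Together with [closedFieldType], this makes [K] an algebraic closure of the
   image of [k]. *)
Definition algebraic_closure (k : fieldType) (K : closedFieldType)
    (iota : {rmorphism k -> K}) : Prop :=
  forall x : K, algebraicOver iota x.

Section PlaneCurve.
Variable K : fieldType.
Implicit Types (f g : {mpoly K[3]}) (P Q : {ffun 'I_3 -> K}).

(* A point of the projective plane is represented by a nonzero vector of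
   homogeneous coordinates.  The condition [f.@[P] = 0] is not redundant, since
   Euler's identity does not give it in characteristic 3. *)
Definition singular_point f P : Prop :=
  [/\ P != 0, f.@[P] = 0 & forall i, (f^`M(i)).@[P] = 0].

(* Equation of the curve in the affine chart [P i != 0], in affine coordinates
   translated so that [P] becomes the origin; 'X_i does not occur in it. *)
Definition local_equation f P (i : 'I_3) : {mpoly K[3]} :=
  f \mPo [tuple if j == i then 1 else 'X_j + (P j / P i)%:MP | j < 3].

(* Homogeneous component of least degree: [mlast] is the least monomial for an
   order which refines the total degree. *)
Definition initial_form g : {mpoly K[3]} :=
  pihomog mdeg (mdeg (mlast g)) g.

(* The tangent cone at [P], cut out by the initial form of the local equation,
   consists of two distinct lines. *)
Definition node f P : Prop :=
  exists2 i : 'I_3, P i != 0 &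
    exists l1 l2 : {mpoly K[3]},
      [/\ l1 \is 1.-homog, l2 \is 1.-homog,
          forall a b : K, a *: l1 + b *: l2 = 0 -> a = 0 /\ b = 0 &
          initial_form (local_equation f P i) = l1 * l2].

Definition irreducible_uninodal f : Prop :=
  irreducible_elt f /\
  exists P, [/\ singular_point f P,
                forall Q, singular_point f Q ->
                  exists c : K, forall i, Q i = c * P i &
                node f P].

End PlaneCurve.

Definition nodal_cubic (k : fieldType) (K : closedFieldType)
    (iota : {rmorphism k -> K}) (f : {mpoly k[3]}) : Prop :=
  f \is 3.-homog /\ irreducible_uninodal (map_mpoly iota f).

Definition in_ideal (R : comNzRingType) (s : seq R) (g : R) : Prop :=
  exists a : 'I_(size s) -> R, g = \sum_i a i * s`_i.

(* [S / (s)] has a [k]-basis with [d] elements, given by the classes of the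
   [e i]. *)
Definition quot_dim (k : fieldType) (S : comAlgType k) (s : seq S)
    (d : nat) : Prop :=
  exists e : 'I_d -> S,
    (forall g : S, exists c : 'rV[k]_d,
       in_ideal s (g - \sum_i c 0 i *: e i)) /\
    (forall c : 'rV[k]_d, in_ideal s (\sum_i c 0 i *: e i) -> c = 0).

Definition HK (k : fieldType) (f : {mpoly k[3]}) (q d : nat) : Prop :=
  quot_dim (f :: [seq 'X_i ^+ q | i : 'I_3]) d.

Section QuotDimUniq.
Variables (k : fieldType) (S : comAlgType k) (s : seq S).

Let in_idealD g h : in_ideal s g -> in_ideal s h -> in_ideal s (g + h).
Proof.
move=> [a ->] [b ->]; exists (fun i => a i + b i).
by rewrite -big_split; apply: eq_bigr => i _; rewrite mulrDl.
Qed.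

Let in_idealZ c g : in_ideal s g -> in_ideal s (c *: g).
Proof.
move=> [a ->]; exists (fun i => c *: a i).
by rewrite scaler_sumr; apply: eq_bigr => i _; rewrite scalerAl.
Qed.

Let in_ideal_sum n (F : 'I_n -> S) :
  (forall i, in_ideal s (F i)) -> in_ideal s (\sum_i F i).
Proof.
move=> sF; elim/big_rec: _ => [|i g _ sg]; last exact: in_idealD.
by exists (fun=> 0); rewrite big1 // => i _; rewrite mul0r.
Qed.

Let quot_dim_le d d' : quot_dim s d -> quot_dim s d' -> (d <= d')%N.
Proof.
move=> [e [_ free_e]] [e' [span_e' _]].
have [c hc] := fin_all_exists (fun i => span_e' (e i)).
pose A := \matrix_(i < d) c i.
suff: row_free A by rewrite /row_free => /eqP <-; apply: rank_leq_col.
rewrite -kermx_eq0; apply/eqP/row_matrixP => i; rewrite row0.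
set u := row i _; have uA : u *m A = 0 by rewrite -row_mul mulmx_ker row0.
apply: free_e.
have -> : \sum_j u 0 j *: e j =
    \sum_j u 0 j *: (e j - \sum_l c j 0 l *: e' l).
  rewrite [RHS](eq_bigr (fun j =>
    u 0 j *: e j - \sum_l (u 0 j * c j 0 l) *: e' l)); last first.
    move=> j _; rewrite scalerBr scaler_sumr; congr (_ - _).
    by apply: eq_bigr => l _; rewrite scalerA.
  rewrite sumrB exchange_big /= [X in _ - X]big1 ?subr0 // => l _.
  rewrite -scaler_suml; have := congr1 (fun M : 'rV_d' => M 0 l) uA.
  rewrite mxE [RHS]mxE => uA_l.
  rewrite (eq_bigr (fun j => u 0 j * A j l)); last by move=> j _; rewrite [A _ _]mxE.
  by rewrite uA_l scale0r.
by apply: in_ideal_sum => j; apply: in_idealZ.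
Qed.

Lemma quot_dim_uniq d d' : quot_dim s d -> quot_dim s d' -> d = d'.
Proof. by move=> h h'; apply/eqP; rewrite eqn_leq !quot_dim_le. Qed.

End QuotDimUniq.

(* Main.v *)
Require Import Defs.
From HB Require Import structures.
From mathcomp Require Import all_boot all_order all_algebra.
From mathcomp Require Import mpoly.
From mathcomp Require Import ring zify.

Import GRing.Theory.
Local Open Scope ring_scope.

(* The dimension of S/(f, x^q, y^q, z^q) is the corank of the matrix of
   multiplication by f on S/(x^q, y^q, z^q), hence it is the same over k and over
   K; by Frobenius it is invariant under linear substitutions.  Over K a nodal
   cubic is equivalent to x y z = x^3 + y^3: if the node is the point (0:0:1) and
   its tangents are x = 0 and y = 0, the equation is x y z + c(x, y) with c a
   binary cubic, and the mixed terms of c are absorbed by z.  Under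
   x = s^2 t, y = s t^2, z = s^3 + t^3, the coordinate ring of this curve is the
   subring of k[s, t] spanned by 1, the s^a t^b with a, b > 0 and 3 | a + b, and
   the s^(3n) + t^(3n).  There x^q, y^q, z^q become s^(2q) t^q, s^q t^(2q) and
   s^(3q) + t^(3q), and the quotient is computed degree by degree on monomials. *)

Set Implicit Arguments.
Unset Strict Implicit.
Unset Printing Implicit Defensive.

(** For m > 0 the coordinate ring has dimension 3(q + m) in degree q + m, and the multiples of each
    of x^q, y^q, z^q form a space of dimension 3m there. For 3m <= q these three spaces are
    independent and the quotient has dimension 3q - 6m. For 3m > q the multiples of y^q and x^q
    together fill all exponents of s from q to 2q + 3m, and what survives has dimension 2q - 1 - 3m,
    or 0 if this is negative. The place where this progression reaches 0 depends on q mod 3, whence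
    the two cases of the formula.

    The two bounds on the dimension are proved separately. Rewriting every monomial to pivots gives
    the upper one, and explicit dual functionals give the lower one. The weights of the functionals
    are integers, so the same argument serves in every characteristic, 2 and 3 included. *)

(** * Monomial induction, ideals and dimensions of quotients *)

Lemma mdeg_succ n (m : 'X_{1..n}) d : mdeg m = d.+1 ->
  exists i (m' : 'X_{1..n}), m = (U_(i) + m')%MM /\ mdeg m' = d.
Proof.
move=> dm; have [i mi] : exists i, (m i != 0)%N.
  apply/existsP; rewrite -negb_forall; apply/negP => /forallP m0.
  by move: dm; rewrite mdegE big1 // => i _; apply/eqP/m0.
have Um : (U_(i) <= m)%MM by rewrite lep1mP.
exists i, (m - U_(i))%MM; rewrite addmC submK //; split=> //.
by apply/eqP; rewrite -eqSS -dm -[in X in _ == X](submK Um) mdegD mdeg1 addn1.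
Qed.

Lemma mpoly_alg_ind n (R : comNzRingType) (P : {mpoly R[n]} -> Prop) :
  (forall c, P c%:MP) -> (forall g h, P g -> P h -> P (g + h)) ->
  (forall i g, P g -> P ('X_i * g)) -> forall g, P g.
Proof.
move=> PC PD PX; elim/mpolyind => [|c m p _ _ Pp]; first by rewrite -mpolyC0.
apply: PD => {p Pp}//; elim: {m}(mdeg m) {-2}m (erefl (mdeg m)) => [|d IH] m.
  by move/eqP; rewrite mdeg_eq0 => /eqP ->; rewrite mpolyX0 alg_mpolyC.
move=> /mdeg_succ[i [m' [-> dm']]]; rewrite mpolyXD scalerAr.
by apply: PX; apply: IH.
Qed.

Section Ideals.
Variables (R : comNzRingType) (s : seq R).

Lemma in_ideal0 : in_ideal s 0.
Proof. by exists (fun=> 0); rewrite big1 // => i _; rewrite mul0r. Qed.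

Lemma in_idealD g h : in_ideal s g -> in_ideal s h -> in_ideal s (g + h).
Proof.
move=> [a ->] [b ->]; exists (fun i => a i + b i).
by rewrite -big_split; apply: eq_bigr => i _; rewrite mulrDl.
Qed.

Lemma in_idealM c g : in_ideal s g -> in_ideal s (c * g).
Proof.
move=> [a ->]; exists (fun i => c * a i).
by rewrite mulr_sumr; apply: eq_bigr => i _; rewrite mulrA.
Qed.

Lemma in_ideal_sum (I : Type) (r : seq I) (Q : pred I) (F : I -> R) :
  (forall i, Q i -> in_ideal s (F i)) -> in_ideal s (\sum_(i <- r | Q i) F i).
Proof.
by move=> sF; elim/big_ind: _ => //; [exact: in_ideal0 | exact: in_idealD].
Qed.

Lemma in_ideal_gen g : g \in s -> in_ideal s g.
Proof.
move=> gs; have ig : (index g s < size s)%N by rewrite index_mem.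
exists (fun i => (i == Ordinal ig)%:R).
rewrite (bigD1 (Ordinal ig)) //= eqxx mul1r nth_index // big1 ?addr0 //.
by move=> i /negPf ->; rewrite mul0r.
Qed.

Lemma in_ideal_ind (P : R -> Prop) :
  P 0 -> (forall g h, P g -> P h -> P (g + h)) ->
  (forall g a, g \in s -> P (a * g)) -> forall g, in_ideal s g -> P g.
Proof.
move=> P0 PD PM g [a ->]; elim/big_ind: _ => // i _.
by apply: PM; apply: mem_nth.
Qed.

End Ideals.

Lemma in_ideal_morph (R R' : comNzRingType) (s : seq R) (s' : seq R')
    (phi : {rmorphism R -> R'}) :
  {in s, forall g, in_ideal s' (phi g)} ->
  forall g, in_ideal s g -> in_ideal s' (phi g).
Proof.
move=> ss'; apply: in_ideal_ind.
- by rewrite rmorph0; apply: in_ideal0.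
- by move=> g h; rewrite rmorphD; apply: in_idealD.
- by move=> g a /ss' sg; rewrite rmorphM; apply: in_idealM.
Qed.

Section QuotDim.
Variables (k : fieldType) (S : comAlgType k).

Lemma in_idealZ (s : seq S) (c : k) g : in_ideal s g -> in_ideal s (c *: g).
Proof. by move=> sg; rewrite -mulr_algl; apply: in_idealM. Qed.

(** Independence is certified by the dual family [lam], so only the spanning property needs a
    reduction procedure. *)
Lemma quot_dim_dual (s : seq S) (T : finType) (e : T -> S)
    (lam : T -> S -> k) :
  (forall t c g h, lam t (c *: g + h) = c * lam t g + lam t h) ->
  (forall t g, in_ideal s g -> lam t g = 0) ->
  (forall t u, lam t (e u) = (t == u)%:R) ->
  (forall g, exists c : T -> k, in_ideal s (g - \sum_t c t *: e t)) ->
  quot_dim s #|T|.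
Proof.
move=> lamP lam_s lam_e span; exists (fun i => e (enum_val i)); split.
  move=> g; have [c sc] := span g; exists (\row_i c (enum_val i)).
  rewrite (reindex _ (onW_bij _ (@enum_val_bij T))) /= in sc.
  rewrite (eq_bigr (fun i => c (enum_val i) *: e (enum_val i))) // => i _.
  by rewrite mxE.
move=> c /lam_s lam0; apply/rowP => i; rewrite [RHS]mxE -(lam0 (enum_val i)).
have lam0_ t : lam t 0 = 0.
  by have := lamP t (-1) 0 0; rewrite scaler0 addr0 mulN1r addNr.
have lam_sum (r : seq 'I_#|T|) t :
    lam t (\sum_(j <- r) c 0 j *: e (enum_val j)) =
    \sum_(j <- r) c 0 j * (t == enum_val j)%:R.
  by elim: r => [|j r IH]; rewrite ?big_nil // !big_cons lamP lam_e IH.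
rewrite lam_sum (bigD1 i) //= eqxx mulr1 big1 ?addr0 // => j ji.
by rewrite (inj_eq enum_val_inj) eq_sym (negPf ji) mulr0.
Qed.

Lemma quot_dim_iso (s t : seq S) (phi psi : {lrmorphism S -> S}) d :
  cancel phi psi -> cancel psi phi ->
  {in s, forall g, in_ideal t (phi g)} ->
  {in t, forall g, in_ideal s (psi g)} ->
  quot_dim s d -> quot_dim t d.
Proof.
move=> phiK psiK st ts [e [span_e free_e]].
have sumE (F : {lrmorphism S -> S}) (c : 'rV[k]_d) (e' : 'I_d -> S) :
    \sum_i c 0 i *: F (e' i) = F (\sum_i c 0 i *: e' i).
  by rewrite linear_sum; apply: eq_bigr => i _; rewrite linearZ.
exists (fun i => phi (e i)); split=> [g|c].
  have [c sc] := span_e (psi g); exists c.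
  by rewrite sumE -[g in g - _]psiK -rmorphB; apply: in_ideal_morph sc.
rewrite sumE => /(in_ideal_morph ts); rewrite /= phiK; exact: free_e.
Qed.

End QuotDim.

Lemma comp_mpolyM n m (R : comNzRingType) (t : n.-tuple {mpoly R[m]}) :
  {morph comp_mpoly t : g h / g * h}.
Proof. exact: rmorphM. Qed.

Lemma comp_mpolyXn n m (R : comNzRingType) (t : n.-tuple {mpoly R[m]}) d :
  {morph comp_mpoly t : g / g ^+ d}.
Proof. exact: rmorphXn. Qed.

(** * Truncation modulo the powers [X_i^q], corank, and change of base field *)

Section Truncation.
Variables (n q : nat).
Let T := {ffun 'I_n -> 'I_q}.
Let mon (i : 'I_#|T|) : 'X_{1..n} := [multinom enum_val i j : nat | j < n].

Definition hk_gens (k : comNzRingType) : seq {mpoly k[n]} :=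
  [seq 'X_i ^+ q | i : 'I_n].

Section Field.
Variable k : fieldType.
Implicit Types (f g : {mpoly k[n]}).

Definition trunc g : 'rV[k]_#|T| := \row_i g@_(mon i).

Definition untrunc (v : 'rV[k]_#|T|) : {mpoly k[n]} :=
  \sum_i v 0 i *: 'X_[mon i].

Definition mul_mx f : 'M[k]_#|T| := \matrix_(i, j) (f * 'X_[mon i])@_(mon j).

Let mon_inj : injective mon.
Proof.
move=> i j /mnmP ij; apply: enum_val_inj; apply/ffunP => l.
by apply/val_inj; have := ij l; rewrite !mnmE.
Qed.

Let monP m : reflect (exists i, m = mon i) [forall i, (m i < q)%N].
Proof.
apply: (iffP forallP) => [mq|[i ->] j]; last by rewrite mnmE.
exists (enum_rank [ffun i => Ordinal (mq i)]); apply/mnmP => i.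
by rewrite mnmE enum_rankK ffunE.
Qed.

Let truncP c g h : trunc (c *: g + h) = c *: trunc g + trunc h.
Proof. by apply/rowP => i; rewrite !mxE mcoeffD mcoeffZ. Qed.

HB.instance Definition _ := GRing.isLinear.Build k {mpoly k[n]} _ _ trunc truncP.

Let untruncP c u v : untrunc (c *: u + v) = c *: untrunc u + untrunc v.
Proof.
rewrite /untrunc scaler_sumr -big_split; apply: eq_bigr => i _ /=.
by rewrite !mxE scalerDl scalerA.
Qed.

HB.instance Definition _ := GRing.isLinear.Build k _ {mpoly k[n]} _ untrunc untruncP.

Let truncX i : trunc 'X_[mon i] = delta_mx 0 i.
Proof.
by apply/rowP => j; rewrite !mxE mcoeffX (inj_eq mon_inj) eqxx eq_sym.
Qed.

Let untruncK : cancel untrunc trunc.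
Proof.
move=> v; rewrite linear_sum [RHS]row_sum_delta; apply: eq_bigr => i _.
by rewrite linearZ /= truncX.
Qed.

Let trunc_big (m : 'X_{1..n}) : ~~ [forall i, (m i < q)%N] -> trunc 'X_[m] = 0.
Proof.
move=> mq; apply/rowP => i; rewrite !mxE mcoeffX; case: eqP => // mi.
by case/monP: mq; exists i.
Qed.

Let trunc_ideal g : in_ideal (hk_gens k) g -> trunc g = 0.
Proof.
move: g; apply: in_ideal_ind => [|g h g0 h0|g a].
- exact: linear0.
- by rewrite linearD /= g0 h0 addr0.
case/mapP => i _ ->; rewrite [a]mpolyE mulr_suml linear_sum big1 // => m _.
rewrite mpolyXn -scalerAl -mpolyXD linearZ /= trunc_big ?scaler0 //.
apply/negP => /forallP/(_ i).
by rewrite mnmDE mulmnE mnm1E eqxx mul1n ltnNge leq_addl.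
Qed.

Let untrunc_trunc g : in_ideal (hk_gens k) (g - untrunc (trunc g)).
Proof.
rewrite [g]mpolyE [trunc _]linear_sum [untrunc _]linear_sum -sumrB /=; apply: in_ideal_sum => m _.
rewrite [trunc _]linearZ [untrunc _]linearZ -scalerBr /=; apply: in_idealZ.
have [/monP[i ->]|mq] := boolP [forall i, (m i < q)%N].
  rewrite truncX /untrunc (bigD1 i) //= mxE !eqxx scale1r big1.
    by rewrite addr0 subrr; apply: in_ideal0.
  by move=> j /negPf ji; rewrite mxE ji scale0r.
rewrite trunc_big // linear0 subr0.
move: mq; rewrite negb_forall => /existsP[i]; rewrite -leqNgt => qm.
have Um : (U_(i) *+ q <= m)%MM.
  apply/mnm_lepP => j; rewrite mulmnE mnm1E.
  by have [<-|_] := eqVneq i j; rewrite ?mul1n ?mul0n.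
rewrite -(submK Um) mpolyXD; apply: in_idealM.
by rewrite -mpolyXn; apply: in_ideal_gen; apply: map_f; rewrite mem_enum.
Qed.

Let trunc_mul f g : trunc (f * g) = trunc g *m mul_mx f.
Proof.
rewrite -{1}[g](subrK (untrunc (trunc g))) mulrDr linearD /=.
rewrite trunc_ideal ?add0r; last exact: in_idealM.
set v := trunc g; rewrite /untrunc mulr_sumr linear_sum mulmx_sum_row.
apply: eq_bigr => i _; rewrite -scalerAr linearZ /=; congr (_ *: _).
by apply/rowP => j; rewrite !mxE.
Qed.

(** [trunc] and [untrunc] are inverse to each other up to the powers [X_i^q], and modulo these
    powers the multiples of [f] are the row space of [mul_mx f]. Ideal membership thus becomes
    linear algebra. *)
Let in_idealE f g :
  in_ideal (f :: hk_gens k) g <-> (trunc g <= mul_mx f)%MS.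
Proof.
split.
  move: g; apply: in_ideal_ind => [|g h g0 h0|g a].
  - by rewrite linear0 sub0mx.
  - by rewrite linearD /= addmx_sub.
  rewrite inE => /orP[/eqP ->|gs].
    by rewrite mulrC trunc_mul submxMl.
  rewrite trunc_ideal ?sub0mx //; apply: in_idealM; exact: in_ideal_gen.
case/submxP => v gv.
have sub h : in_ideal (hk_gens k) h -> in_ideal (f :: hk_gens k) h.
  move: h; apply: in_ideal_ind => [|h h'|h a hs].
  - exact: in_ideal0.
  - exact: in_idealD.
  by apply/in_idealM/in_ideal_gen; rewrite inE hs orbT.
rewrite -[g](subrK (f * untrunc v)); apply: in_idealD; last first.
  by rewrite mulrC; apply/in_idealM/in_ideal_gen; rewrite inE eqxx.
rewrite -[_ - _](subrK (untrunc (trunc (g - f * untrunc v)))).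
apply: in_idealD; first exact/sub/untrunc_trunc.
by rewrite linearB /= trunc_mul untruncK gv subrr linear0; apply: in_ideal0.
Qed.

Lemma quot_dim_rank f :
  quot_dim (f :: hk_gens k) (\rank (mul_mx f)^C%MS).
Proof.
set B := row_base (mul_mx f)^C%MS.
have sumB (c : 'rV_(\rank (mul_mx f)^C%MS)) :
    trunc (\sum_i c 0 i *: untrunc (row i B)) = c *m B.
  rewrite linear_sum mulmx_sum_row; apply: eq_bigr => i _.
  by rewrite linearZ /= untruncK.
exists (fun i => untrunc (row i B)); split=> [g|c].
  have : (trunc g <= mul_mx f + B)%MS.
    apply: submx_full; rewrite /row_full.
    rewrite (adds_eqmx (eqmx_refl _) (eq_row_base _)).
    exact: addsmx_compl_full.
  case/sub_addsmxP => -[u v] /= gE; exists v.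
  by apply/in_idealE; rewrite linearB /= sumB gE addrK submxMl.
move/in_idealE; rewrite sumB => cB.
have: (c *m B <= mul_mx f :&: (mul_mx f)^C)%MS.
  rewrite sub_capmx cB; apply: submx_trans (submxMl _ _) _.
  by rewrite eq_row_base.
rewrite capmx_compl submx0 => /eqP /(congr1 (mulmx^~ (pinvmx B))) /=.
by rewrite mul0mx mulmxKp ?row_base_free.
Qed.

End Field.

Lemma quot_dim_map (k K : fieldType) (iota : {rmorphism k -> K})
    (f : {mpoly k[n]}) d :
  quot_dim (map_mpoly iota f :: hk_gens K) d -> quot_dim (f :: hk_gens k) d.
Proof.
move/(quot_dim_uniq (quot_dim_rank (map_mpoly iota f))) => <-.
suff -> : mul_mx (map_mpoly iota f) = map_mx iota (mul_mx f).
  by rewrite -map_complmx mxrank_map; apply: quot_dim_rank.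
apply/matrixP => i j; rewrite !mxE -mcoeff_map_mpoly rmorphM /=.
by rewrite map_mpolyX.
Qed.

End Truncation.

(** * Linear substitutions and Frobenius *)

Section LinearChange.
Variables (n : nat) (k : fieldType).
Local Notation S := {mpoly k[n]}.

Definition lin_subst (M : 'M[k]_n) : n.-tuple S :=
  [tuple \sum_j M i j *: 'X_j | i < n].

Lemma comp_lin_substX M i : 'X_i \mPo lin_subst M = \sum_j M i j *: 'X_j.
Proof. by rewrite comp_mpolyXU -tnth_nth tnth_mktuple. Qed.

Lemma comp_lin_subst1 (g : S) : g \mPo lin_subst 1%:M = g.
Proof.
rewrite -[RHS]comp_mpoly_id; congr comp_mpoly; apply: eq_from_tnth => i.
rewrite !tnth_mktuple (bigD1 i) //= mxE eqxx scale1r big1 ?addr0 // => j ji.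
by rewrite mxE eq_sym (negPf ji) scale0r.
Qed.

Lemma comp_lin_substM (M N : 'M[k]_n) (g : S) :
  (g \mPo lin_subst N) \mPo lin_subst M = g \mPo lin_subst (N *m M).
Proof.
elim/mpoly_alg_ind: g => [c|g h gE hE|i g gE]; first by rewrite !comp_mpolyC.
  by rewrite !comp_mpolyD gE hE.
rewrite !comp_mpolyM gE; apply: (congr1 (fun h => h * _)); rewrite !comp_lin_substX linear_sum /=.
under eq_bigr do rewrite comp_mpolyZ comp_lin_substX scaler_sumr.
rewrite exchange_big /=; apply: eq_bigr => j _.
by rewrite mxE scaler_suml; apply: eq_bigr => l _; rewrite scalerA.
Qed.

Variables (p e : nat).
Hypothesis charp : p \in [pchar k].

Lemma pchar_nat_exp (R : nzSemiRingType) : p \in [pchar R] -> [pchar R].-nat (p ^ e)%N.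
Proof.
move=> pR; rewrite (eq_pnat _ (pcharf_eq pR)).
by rewrite pnatX pnat_id ?orbT // (pcharf_prime pR).
Qed.

(** The prefix [s] leaves room for the equation of the curve in front of the powers of the
    variables. *)
Lemma comp_lin_subst_gens (M : 'M[k]_n) (g : S) (s : seq S) :
  g \in hk_gens n (p ^ e) k ->
  in_ideal (s ++ hk_gens n (p ^ e) k) (g \mPo lin_subst M).
Proof.
case/mapP => i _ ->; rewrite rmorphXn /= comp_lin_substX.
have pS : p \in [pchar S] by apply: (rmorph_pchar (mpolyC n (R := k))).
have -> : (\sum_j M i j *: 'X_j) ^+ (p ^ e) =
    \sum_j (M i j *: 'X_j : S) ^+ (p ^ e).
  elim/big_rec2: _ => [|j u v _ <-]; last by rewrite exprDn_pchar ?pchar_nat_exp.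
  by rewrite expr0n expn_eq0 (gtn_eqF (prime_gt0 (pcharf_prime charp))).
apply: in_ideal_sum => j _; rewrite exprZn; apply/in_idealZ/in_ideal_gen.
by rewrite mem_cat; apply/orP; right; apply: image_f.
Qed.

Lemma quot_dim_lin_subst (M : 'M[k]_n) (f : S) d : M \in unitmx ->
  quot_dim (f :: hk_gens n (p ^ e) k) d ->
  quot_dim (f \mPo lin_subst M :: hk_gens n (p ^ e) k) d.
Proof.
move=> uM; apply: (quot_dim_iso (phi := comp_mpoly (lin_subst M))
  (psi := comp_mpoly (lin_subst (invmx M)))) => g.
- by rewrite /= comp_lin_substM mulmxV ?comp_lin_subst1.
- by rewrite /= comp_lin_substM mulVmx ?comp_lin_subst1.
- rewrite inE => /orP[/eqP ->|gs]; last exact: (@comp_lin_subst_gens M g [:: _]).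
  by apply: in_ideal_gen; rewrite inE eqxx.
rewrite inE => /orP[/eqP ->|gs]; last exact: (@comp_lin_subst_gens (invmx M) g [:: _]).
rewrite /= comp_lin_substM mulmxV // comp_lin_subst1.
by apply: in_ideal_gen; rewrite inE eqxx.
Qed.

End LinearChange.

(** * Pivots and dual weights *)

Section Weights.
Variable q : nat.

(* The index (n, j) stands for the monomial s^j t^(3n-j) of degree 3n, and
   (n, 0) for s^(3n) + t^(3n) (for 1 if n = 0).  The pivots index a basis of the
   quotient of the coordinate ring by (x^q, y^q, z^q); in [pivot_hi] the degree
   is n = q + m. *)
Definition pivot_hi (m j : nat) : bool :=
  [|| [&& m == 0, 0 < j, j < 3 * q, j != q & j != 2 * q],
      [&& 0 < m, 3 * m <= q & [|| (3 * m <= j < q), (q + 3 * m <= j < 2 * q)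
         | (2 * q + 3 * m <= j < 3 * q + 3 * m)]]
    | (q < 3 * m) && (2 * q + 3 * m < j < 4 * q)]%N.

Definition pivot (n j : nat) : bool :=
  (if n < q then j < maxn 1 (3 * n) else pivot_hi (n - q) j)%N.

(* [weight n j] is the coefficient vector of a linear form in degree n which
   kills (x^q, y^q, z^q) and is dual to the pivot (n, j).  For n = q + m with
   m > 0 and e_a = s^a t^(3n-a), it must vanish on e_a (q < a < q + 3m or
   2q < a < 2q + 3m), e_q + e_(q+3m), e_(2q) + e_(2q+3m), e_a + e_(3q+a)
   (0 < a < 3m) and e_0 + e_(3n) + e_(3m) + e_(3q). *)
Definition correction (m j a : nat) : int :=
  [&& 3 * m < q, j == 3 * m & a == 0]%N%:Z
  + [&& 3 * m < q, j == q + 3 * m & a == q]%N%:Z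
  + [&& 3 * m < q, j == 2 * q + 3 * m & a == 2 * q]%N%:Z
  + (a + 3 * q == j)%N%:Z
  + [&& 3 * m == q, j == 3 * q & a == 0]%N%:Z
  + [&& 3 * m == q, j == 3 * q & a == 2 * q]%N%:Z
  - [&& 3 * m == q, j == 3 * q & a == q]%N%:Z.

Definition weight (n j a : nat) : int :=
  (a == j)%:Z - (if (n <= q)%N then 0 else correction (n - q) j a).

Lemma pivot_q j : pivot q j = [&& 0 < j, j < 3 * q, j != q & j != 2 * q]%N.
Proof. by rewrite /pivot ltnn subnn /pivot_hi; lia. Qed.

Lemma weight_q j a : weight q j a = (a == j)%:Z.
Proof. by rewrite /weight leqnn subr0. Qed.

Lemma weight_q_eq0 j a : pivot q j -> a \in [:: 0; q; 2 * q; 3 * q]%N ->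
  weight q j a = 0.
Proof.
rewrite pivot_q weight_q => /and4P[j0 jq3 jq jq2]; rewrite !inE.
by have [->|//] := eqVneq a j; rewrite (negPf jq) (negPf jq2) (gtn_eqF j0) (ltn_eqF jq3).
Qed.

Variables (m j : nat).
Hypothesis m_gt0 : (0 < m)%N.
Hypothesis j_pivot : pivot_hi m j.

Lemma pivotE : pivot (q + m) j = pivot_hi m j.
Proof. by rewrite /pivot ltnNge leq_addr addKn. Qed.

Let weightE a : weight (q + m) j a = (a == j)%:Z - correction m j a.
Proof. by rewrite /weight addKn ifF //; lia. Qed.

(** The case 3m = q is separate because the end points of the windows then coincide and the
    relations chain up: modulo the ideal, e_(2q) = - e_(3q), e_q = e_(3q) and e_0 + e_(3n) = - 2
    e_(3q). This explains the last two terms of [correction] and the weight -2 at a = 0, to which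
    both [a + 3 * q == j] and the term before those two contribute. *)
Ltac solve_weight :=
  rewrite /correction; move: j_pivot; rewrite /pivot_hi m_gt0 (gtn_eqF m_gt0) /=;
  case: (ltngtP (3 * m) q) => _mq /=; rewrite ?orbF /=;
  [ case/or3P => /andP[P1 P2] | case/andP => P1 P2 | case/or3P => /andP[P1 P2]];
  repeat (case: eqP => [?|?] /=; try (exfalso; lia)); lia.

Lemma weight_x a : (2 * q < a < 2 * q + 3 * m)%N -> weight (q + m) j a = 0.
Proof. rewrite !weightE; solve_weight. Qed.
Lemma weight_y a : (q < a < q + 3 * m)%N -> weight (q + m) j a = 0.
Proof. rewrite !weightE; solve_weight. Qed.
Lemma weight_z a : (0 < a < 3 * m)%N ->
  weight (q + m) j (3 * q + a) + weight (q + m) j a = 0.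
Proof. rewrite !weightE; solve_weight. Qed.
Lemma weight_xe : weight (q + m) j (2 * q + 3 * m) + weight (q + m) j (2 * q) = 0.
Proof. rewrite !weightE; solve_weight. Qed.
Lemma weight_ye : weight (q + m) j (q + 3 * m) + weight (q + m) j q = 0.
Proof. rewrite !weightE; solve_weight. Qed.
Lemma weight_ze : weight (q + m) j (3 * q + 3 * m) + weight (q + m) j (3 * m)
   + weight (q + m) j (3 * q) + weight (q + m) j 0 = 0.
Proof. rewrite !weightE; solve_weight. Qed.
Lemma weight_pivot i : pivot_hi m i -> weight (q + m) j i = (i == j)%:Z.
Proof. rewrite !weightE; solve_weight. Qed.

End Weights.

(** * Polynomials in three variables *)

Definition ord30 : 'I_3 := @Ordinal 3 0 isT.
Definition ord31 : 'I_3 := @Ordinal 3 1 isT.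
Definition ord32 : 'I_3 := @Ordinal 3 2 isT.

Lemma ord3_ind (P : 'I_3 -> Prop) : P ord30 -> P ord31 -> P ord32 -> forall i, P i.
Proof.
move=> P0 P1 P2 [[|[|[|//]]] i3].
- by rewrite (_ : Ordinal i3 = ord30) //; apply/val_inj.
- by rewrite (_ : Ordinal i3 = ord31) //; apply/val_inj.
- by rewrite (_ : Ordinal i3 = ord32) //; apply/val_inj.
Qed.

Lemma big_ord3 (R : Type) (idx : R) (op : Monoid.law idx) (G : 'I_3 -> R) :
  \big[op/idx]_i G i = op (op (G ord30) (G ord31)) (G ord32).
Proof.
rewrite !big_ord_recr big_ord0 /= Monoid.mul1m.
by congr (op (op (G _) (G _)) (G _)); apply/val_inj.
Qed.

Lemma mpolyX_dvd n (R : comNzRingType) (i : 'I_n) (g : {mpoly R[n]}) :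
  exists h, g = 'X_i * h + (g \mPo [tuple if j == i then 0 else 'X_j | j < n]).
Proof.
elim/mpoly_alg_ind: g => [c|g1 g2 [h1 e1] [h2 e2]|j g [h e]].
- by exists 0; rewrite mulr0 add0r comp_mpolyC.
- by exists (h1 + h2); rewrite {1}e1 {1}e2 rmorphD /=; ring.
- rewrite rmorphM /= comp_mpolyXU -tnth_nth tnth_mktuple.
  have [->|ji] := eqVneq j i; first by exists g; rewrite mul0r addr0.
  by exists ('X_j * h); rewrite {1}e; ring.
Qed.

(** * The parametrised nodal cubic x = s^2 t, y = s t^2, z = s^3 + t^3 *)

Section NodalCurve.
Variable F : fieldType.
Local Notation S := {mpoly F[3]}.
Local Notation B := {poly {poly F}}.
Local Notation x := ('X_ord30 : S).
Local Notation y := ('X_ord31 : S).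
Local Notation z := ('X_ord32 : S).

Definition nodal : S := x * y * z - x ^+ 3 - y ^+ 3.

(** The monomial s^a t^b, with s the inner and t the outer variable. *)
Definition bimon (a b : nat) : B := ('X^a)%:P * 'X^b.

Lemma bimonM a b c d : bimon a b * bimon c d = bimon (a + c) (b + d).
Proof. by rewrite /bimon !exprD polyCM; ring. Qed.

Lemma bimonX a b n : bimon a b ^+ n = bimon (a * n) (b * n).
Proof. by rewrite /bimon exprMn -polyC_exp -!exprM. Qed.

Lemma coef_bimon a b i j : (bimon a b)`_j`_i = ((i == a) && (j == b))%:R.
Proof.
rewrite /bimon coefCM coefXn; case: (j == b).
  by rewrite mulr1 coefXn andbT.
by rewrite mulr0 coef0 andbF.
Qed.

Definition param_coord (i : 'I_3) : B :=
  [:: bimon 2 1; bimon 1 2; bimon 3 0 + bimon 0 3]`_i.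

Definition param : {rmorphism S -> B} := mmap (polyC \o polyC) param_coord.

Lemma paramX i : param 'X_i = param_coord i.
Proof. by rewrite /= mmapX mmap1U. Qed.

Lemma paramC c : param c%:MP = c%:P%:P.
Proof. by rewrite /= mmapC. Qed.

Lemma paramZ c g : param (c *: g) = c%:P%:P * param g.
Proof. by rewrite -mul_mpolyC rmorphM /= paramC. Qed.

Lemma param_nodal : param nodal = 0.
Proof.
rewrite /nodal !rmorphB !rmorphXn !rmorphM /= !paramX /param_coord /=.
by rewrite !bimonX mulrDr !bimonM; ring.
Qed.

(** Freeness from z is expressed as invariance under z := 0, so closure under sums and products
    follows from the morphism laws. *)
Let in_xy (h : S) := h = h \mPo [tuple if j == ord32 then 0 else 'X_j | j < 3].

(** The monomial x^a y^b goes to s^(2a+b) t^(a+2b). This map on exponents has determinant 3, so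
    distinct monomials have distinct images and each coefficient of [h] can be read off in
    [param h]. *)
Let in_xy_inj h : in_xy h -> param h = 0 -> h = 0.
Proof.
move=> hxy h0.
have hz (m : 'X_{1..3}) : h@_m != 0 -> m ord32 = 0%N.
  apply: contra_neq_eq => mz; rewrite hxy comp_mpolyE raddf_sum big1 //= => m' _.
  rewrite mcoeffZ big_ord3 /= !tnth_mktuple /= !mpolyXn -mpolyXD.
  case: (m' ord32) => [|l]; last by rewrite expr0n mulr0 mcoeff0 mulr0.
  rewrite expr0 mulr1 mcoeffX; case: eqP; rewrite ?mulr0 // => mE.
  by case/negP: mz; rewrite -mE mnmDE !mulmnE !mnm1E.
apply/mpolyP => m; rewrite mcoeff0; apply/eqP/negPn/negP => hm.
have mz := hz _ hm; case/eqP: (hm).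
have <- : (param h)`_(m ord30 + 2 * m ord31)`_(2 * m ord30 + m ord31) = h@_m.
  rewrite {1}[h]mpolyE rmorph_sum /= !coef_sum (bigD1_seq m) ?msupp_uniq ?mcoeff_msupp //=.
  have coefE m' : h@_m' != 0 ->
      (param (h@_m' *: 'X_[m']))`_(m ord30 + 2 * m ord31)`_(2 * m ord30 + m ord31)
        = h@_m' * (m' == m)%:R.
    move=> hm'; have mz' := hz _ hm'; rewrite paramZ !coefCM /= mmapX /mmap1.
    rewrite big_ord3 /= mz' expr0 mulr1 /param_coord /= !bimonX bimonM coef_bimon.
    congr (_ * _%:R); congr (nat_of_bool _).
    apply/idP/eqP => [|->]; last by lia.
    case/andP => /eqP h1 /eqP h2; apply/mnmP; apply: ord3_ind; lia.
  rewrite coefE // eqxx mulr1 big_seq_cond big1 ?addr0 // => m' /andP[+ m'm].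
  by rewrite mcoeff_msupp => /coefE ->; rewrite (negPf m'm) mulr0.
by rewrite h0 !coef0.
Qed.

(** At [X_i = 0] the equation becomes minus the cube of another variable, which is nonzero. Hence
    [h] vanishes at [X_i = 0], that is, [X_i] divides [h] and can be cancelled. *)
Let nodal_dvdX i g h : i != ord32 -> 'X_i * g = nodal * h ->
  exists h', g = nodal * h'.
Proof.
move=> iz E; set u := [tuple if j == i then 0 else 'X_j : S | j < 3].
have [h' hE] := mpolyX_dvd i h.
have X0 : ('X_i : S) != 0.
  by rewrite -msize_poly_eq0 msizeX.
exists h'; apply: (mulfI X0); rewrite E {1}hE -/u.
suff -> : h \mPo u = 0 by ring.
have : (nodal \mPo u) * (h \mPo u) = 0.
  by rewrite -rmorphM /= -E rmorphM /= comp_mpolyXU -tnth_nth tnth_mktuple eqxx mul0r.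
move/eqP; rewrite mulf_eq0 => /orP[|/eqP //].
rewrite /nodal !rmorphB !rmorphXn !rmorphM /= !comp_mpolyXU -!tnth_nth !tnth_mktuple.
have Xn0 (j : 'I_3) n : ('X_j : S) ^+ n != 0.
  by rewrite expf_neq0 // -msize_poly_eq0 msizeX.
move: iz; elim/ord3_ind: (i) => //= _.
  by rewrite !mul0r expr0n /= subr0 sub0r oppr_eq0 (negPf (Xn0 _ _)).
by rewrite mulr0 mul0r expr0n /= subr0 sub0r oppr_eq0 (negPf (Xn0 _ _)).
Qed.

(* Modulo the equation, x y z = x^3 + y^3, so some (x y)^N g is congruent to a
   polynomial in x and y, on which [param] is injective; and x and y are not
   zero divisors modulo the equation. *)
Lemma param_ker g : param g = 0 -> exists h, g = nodal * h.
Proof.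
have [N [h [a [hxy gE]]]] : exists N h a,
    in_xy h /\ (x * y) ^+ N * g = h + nodal * a.
  have in_xyX i : i != ord32 -> in_xy 'X_i.
    by move=> iz; rewrite /in_xy comp_mpolyXU -tnth_nth tnth_mktuple (negPf iz).
  have in_xyM h1 h2 : in_xy h1 -> in_xy h2 -> in_xy (h1 * h2).
    by move=> e1 e2; rewrite /in_xy rmorphM /= -e1 -e2.
  have in_xyXn h1 n : in_xy h1 -> in_xy (h1 ^+ n).
    by move=> e1; rewrite /in_xy rmorphXn /= -e1.
  have in_xyD h1 h2 : in_xy h1 -> in_xy h2 -> in_xy (h1 + h2).
    by move=> e1 e2; rewrite /in_xy rmorphD /= -e1 -e2.
  have xyP := in_xyM _ _ (in_xyX ord30 isT) (in_xyX ord31 isT).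
  elim/mpoly_alg_ind: g => [c|g1 g2 [N1 [h1 [a1 [p1 e1]]]] [N2 [h2 [a2 [p2 e2]]]]|i g [N [h [a [p e]]]]].
  - exists 0, c%:MP, 0; rewrite /in_xy comp_mpolyC; split=> //; ring.
  - exists (N1 + N2), ((x * y) ^+ N2 * h1 + (x * y) ^+ N1 * h2),
      ((x * y) ^+ N2 * a1 + (x * y) ^+ N1 * a2); split.
      by apply/in_xyD; apply/in_xyM => //; apply/in_xyXn.
    transitivity ((x * y) ^+ N2 * ((x * y) ^+ N1 * g1) + (x * y) ^+ N1 * ((x * y) ^+ N2 * g2)).
      by rewrite exprD; ring.
    by rewrite e1 e2; ring.
  - elim/ord3_ind: i.
    + exists N, (x * h), (x * a); split; first exact/in_xyM/p/in_xyX.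
      by rewrite mulrCA e; ring.
    + exists N, (y * h), (y * a); split; first exact/in_xyM/p/in_xyX.
      by rewrite mulrCA e; ring.
    + exists N.+1, ((x ^+ 3 + y ^+ 3) * h), (h + x * y * z * a); split.
        by apply/in_xyM/p/in_xyD; apply/in_xyXn/in_xyX.
      transitivity (x * y * z * ((x * y) ^+ N * g)); first by rewrite exprS; ring.
      by rewrite e /nodal; ring.
move=> g0; have h0 : h = 0.
  apply: in_xy_inj => //; apply/eqP; have /eqP := congr1 param gE.
  by rewrite rmorphM /= g0 mulr0 rmorphD rmorphM /= param_nodal mul0r addr0 eq_sym.
move: gE; rewrite h0 add0r; elim: N a => [|N IH] a; first by rewrite mul1r; exists a.
rewrite exprS -!mulrA => /(nodal_dvdX (isT : ord30 != ord32))[a1].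
by move=> /(nodal_dvdX (isT : ord31 != ord32))[a2]; apply: IH.
Qed.

Definition ends (n : nat) : B := bimon (3 * n) 0 + bimon 0 (3 * n).

(** This is the image of [param]. As an inductive predicate it lets linear statements about the
    coordinate ring be checked on three kinds of generators. *)
Inductive curve_span : B -> Prop :=
| CurveConst c : curve_span c%:P%:P
| CurveMon c a b : (0 < a)%N -> (0 < b)%N -> (3 %| a + b)%N ->
    curve_span (c%:P%:P * bimon a b)
| CurveEnds c n : (0 < n)%N -> curve_span (c%:P%:P * ends n)
| CurveAdd u v : curve_span u -> curve_span v -> curve_span (u + v).

Lemma param_span g : curve_span (param g).
Proof.
elim/mpoly_alg_ind: g => [c|g h|i g].
- by rewrite paramC; constructor.
- by rewrite rmorphD; constructor.
rewrite rmorphM paramX.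
have xyP a b u : (0 < a)%N -> (0 < b)%N -> (3 %| a + b)%N ->
    curve_span u -> curve_span (bimon a b * u).
  move=> a0 b0 ab; elim=> {u}[c|c a' b' a'0 b'0 ab'|c n n0|u v _ hu _ hv].
  - by rewrite mulrC; constructor.
  - by rewrite mulrCA bimonM; constructor; lia.
  - rewrite mulrCA [_ * ends n]mulrDr !bimonM mulrDr.
    by constructor; constructor; lia.
  - by rewrite mulrDr; constructor.
elim/ord3_ind: i; [exact: xyP | exact: xyP | rewrite /param_coord /=].
elim=> {g}[c|c a b a0 b0 ab|c n n0|u v _ hu _ hv].
- by rewrite mulrC; apply: (CurveEnds _ (isT : 0 < 1)%N).
- by rewrite mulrCA mulrDl !bimonM mulrDr; constructor; constructor; lia.
- have -> : (bimon 3 0 + bimon 0 3) * (c%:P%:P * ends n) =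
      c%:P%:P * ends n.+1 + (c%:P%:P * bimon 3 (3 * n) + c%:P%:P * bimon (3 * n) 3).
    rewrite /ends mulrCA mulrDl !mulrDr !bimonM !mulnS !addn0 !add0n; ring.
  by constructor; [|constructor]; constructor; lia.
- by rewrite mulrDr; constructor.
Qed.

(** Factor out x or y while both exponents stay positive. Apart from x and y themselves, this fails
    only for s^a t and s t^b, which are obtained through z. *)
Lemma param_mon n a b : (0 < a)%N -> (0 < b)%N -> (a + b = 3 * n)%N ->
  exists g, param g = bimon a b.
Proof.
elim/ltn_ind: n a b => -[|n] IH a b a0 b0 abn; first by lia.
have [a1|a1] := leqP a 2; last first.
  have [b1|b1] := leqP b 1; last first.
    have [||||g gE] := IH n _ (a - 2)%N (b - 1)%N; try lia.
    exists (x * g); rewrite rmorphM paramX gE /param_coord /= bimonM.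
    by congr bimon; lia.
  have [||||g gE] := IH n _ (a - 3)%N b; try lia.
  have [||||h hE] := IH n _ (a - 4)%N 2; try lia.
  (* Here b = 1 and 3 divides a + 1, so a >= 5, and s^a t = (s^3 + t^3) s^(a-3) t - (s t^2) s^(a-4)
     t^2. *)
  exists (z * g - y * h).
  rewrite rmorphB !rmorphM !paramX gE hE /param_coord /= mulrDl !bimonM.
  have -> : (3 + (a - 3) = a)%N by lia.
  have -> : (b = 1)%N by lia.
  have -> : (1 + (a - 4) = 0 + (a - 3))%N by lia.
  by rewrite addrK.
have [b1|b1] := leqP b 2.
  have [aE|aE] : a = 1%N \/ a = 2%N by lia.
    by exists y; rewrite paramX /param_coord /=; congr bimon; lia.
  by exists x; rewrite paramX /param_coord /=; congr bimon; lia.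
have [a2|a2] := leqP a 1; last first.
  have [||||g gE] := IH n _ (a - 1)%N (b - 2)%N; try lia.
  exists (y * g); rewrite rmorphM paramX gE /param_coord /= bimonM.
  by congr bimon; lia.
have [||||g gE] := IH n _ a (b - 3)%N; try lia.
have [||||h hE] := IH n _ 2 (b - 4)%N; try lia.
exists (z * g - x * h).
rewrite rmorphB !rmorphM !paramX gE hE /param_coord /= mulrDl !bimonM.
have -> : (3 + (b - 3) = b)%N by lia.
have -> : (a = 1)%N by lia.
have -> : (1 + (b - 4) = 0 + (b - 3))%N by lia.
by rewrite addrAC subrr add0r.
Qed.

Lemma param_ends n : (0 < n)%N -> exists g, param g = ends n.
Proof.
case: n => // n _; elim: n => [|n [g gE]].
  by exists z; rewrite paramX.
have [|||g1 g1E] := @param_mon n.+2 3 (3 * n.+1); try lia.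
have [|||g2 g2E] := @param_mon n.+2 (3 * n.+1) 3; try lia.
(* Multiplying [ends n.+1] by s^3 + t^3 gives [ends n.+2] and the two mixed monomials lifted by [g1]
   and [g2]. *)
exists (z * g - g1 - g2).
rewrite !rmorphB rmorphM paramX gE g1E g2E /param_coord /= /ends !mulrDl !mulrDr.
by rewrite !bimonM !mulnS !addn0 !add0n; ring.
Qed.

(** * The quotient of the coordinate ring: dual functionals and reduction to pivots *)

Section HilbertKunz.
Variable q : nat.
Hypothesis q_gt0 : (0 < q)%N.
Hypothesis frob : (bimon 3 0 + bimon 0 3) ^+ q = ends q.

Let J : seq S := nodal :: hk_gens 3 q F.

Definition functional (n j : nat) (u : B) : F :=
  \sum_(a < (3 * n).+1) (weight q n j a)%:~R * u`_(3 * n - a)`_a.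

Let functionalP n j c u v :
  functional n j (c%:P%:P * u + v) = c * functional n j u + functional n j v.
Proof.
rewrite mulr_sumr -big_split; apply: eq_bigr => a _ /=.
by rewrite !coefD !coefCM mulrDr mulrCA.
Qed.

Let functionalD n j u v :
  functional n j (u + v) = functional n j u + functional n j v.
Proof. by have := functionalP n j 1 u v; rewrite !mul1r. Qed.

Let functional_mon n j c a b : functional n j (c%:P%:P * bimon a b) =
  if (a + b == 3 * n)%N then c * (weight q n j a)%:~R else 0.
Proof.
have E (i : 'I_(3 * n).+1) : (weight q n j i)%:~R *
    (c%:P%:P * bimon a b)`_(3 * n - i)`_i =
    c * ((weight q n j i)%:~R * ((i == a :> nat) && (3 * n - i == b)%N)%:R).
  by rewrite 2!coefCM coef_bimon mulrCA.
rewrite /functional (eq_bigr _ (fun i _ => E i)) -mulr_sumr; case: eqP => abn.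
  have an : (a < (3 * n).+1)%N by lia.
  rewrite (bigD1 (Ordinal an)) //= eqxx big1 ?addr0.
    by rewrite (_ : (_ == b) = true) ?mulr1 //; lia.
  by move=> i; rewrite -val_eqE /= => /negPf ->; rewrite mulr0.
rewrite big1 ?mulr0 // => i _; rewrite (_ : _ && _ = false) ?mulr0 //.
by apply/negP => /andP[/eqP ia /eqP ib]; have := ltn_ord i; lia.
Qed.

Let param_coordXq (i : 'I_3) : param_coord i ^+ q =
  [:: bimon (2 * q) q; bimon q (2 * q); ends q]`_i.
Proof.
elim/ord3_ind: i; rewrite /param_coord /= ?frob // bimonX.
- by rewrite mul1n.
- by rewrite mul1n.
Qed.

(** Each kind of generator [u] meets its own relations: constants matter only in degree q, interior
    monomials of degree 3m call for [weight_x], [weight_y], [weight_z], and the sums [ends m] call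
    for [weight_xe], [weight_ye], [weight_ze]. In all other degrees the functional sees nothing. *)
Let functional_ideal n j u i : pivot q n j -> curve_span u ->
  functional n j (u * param_coord i ^+ q) = 0.
Proof.
move=> nj; rewrite param_coordXq; elim=> {u}[c|c a b a0 b0 ab|c k k0|u v _ hu _ hv].
- have w0 a : a \in [:: 0; q; 2 * q; 3 * q]%N -> n = q ->
      (weight q n j a)%:~R = 0 :> F.
    by move=> aq nq; move: nj; rewrite nq => /weight_q_eq0 ->.
  elim/ord3_ind: i => /=; rewrite ?mulrDr ?functionalD !functional_mon.
  + by case: eqP => // qn; rewrite w0 ?mulr0 ?inE ?eqxx ?orbT //; lia.
  + by case: eqP => // qn; rewrite w0 ?mulr0 ?inE ?eqxx ?orbT //; lia.
  + rewrite add0n addn0; case: eqP => [qn|_]; last by rewrite addr0.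
    by rewrite !w0 ?mulr0 ?addr0 ?inE ?eqxx ?orbT //; lia.
- have [qn|/eqP qn] := eqVneq (a + b + 3 * q)%N (3 * n)%N; last first.
    elim/ord3_ind: i; rewrite /= -mulrA ?bimonM ?mulrDr ?bimonM ?mulrDr ?functionalD functional_mon ifF ?functional_mon ?ifF ?addr0 //; lia.
  have [m m0 nE] : exists2 m, (0 < m)%N & n = (q + m)%N by exists (n - q)%N; lia.
  have mj : pivot_hi q m j by move: nj; rewrite nE pivotE.
  elim/ord3_ind: i; rewrite /= -mulrA.
  + rewrite bimonM functional_mon nE [(a + 2 * q)%N]addnC (weight_x m0 mj) ?mulr0 ?if_same //; lia.
  + rewrite bimonM functional_mon nE [(a + q)%N]addnC (weight_y m0 mj) ?mulr0 ?if_same //; lia.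
  + rewrite mulrDr !bimonM mulrDr functionalD !functional_mon !addn0.
    rewrite !ifT; try lia; rewrite -mulrDr -rmorphD nE [(a + 3 * q)%N]addnC (weight_z m0 mj) ?mulr0 //.
    lia.
- have [qn|/eqP qn] := eqVneq (k + q)%N n; last first.
    elim/ord3_ind: i; rewrite /= -mulrA /ends ?mulrDl ?mulrDr ?bimonM ?mulrDr ?bimonM ?mulrDr ?functionalD !functional_mon !ifF ?addr0 //; lia.
  have nE : n = (q + k)%N by lia.
  have mj : pivot_hi q k j by move: nj; rewrite nE pivotE.
  elim/ord3_ind: i; rewrite /= -mulrA /ends.
  + rewrite mulrDl !bimonM mulrDr functionalD !functional_mon !add0n.
    rewrite !ifT; try lia; rewrite -mulrDr -rmorphD nE [(3 * k + _)%N]addnC.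
    by rewrite (weight_xe k0 mj) mulr0.
  + rewrite mulrDl !bimonM mulrDr functionalD !functional_mon !add0n.
    rewrite !ifT; try lia; rewrite -mulrDr -rmorphD nE [(3 * k + _)%N]addnC.
    by rewrite (weight_ye k0 mj) mulr0.
  + rewrite mulrDl !mulrDr !bimonM !functionalD !functional_mon !add0n !addn0.
    rewrite !ifT; try lia; rewrite -!mulrDr -!rmorphD nE [(3 * k + _)%N]addnC.
    by rewrite addrA (weight_ze k0 mj) mulr0.
- by rewrite mulrDl functionalD hu hv addr0.
Qed.

Let functionalZ n j c u : functional n j (c%:P%:P * u) = c * functional n j u.
Proof.
have := functionalP n j c u 0; rewrite addr0 => ->.
rewrite [functional n j 0]big1 ?addr0 // => a _.
by rewrite !coef0 mulr0.
Qed.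

Let elem (n j : nat) : B :=
  if j == 0%N then (if n == 0%N then 1 else ends n) else bimon j (3 * n - j).

Let pivot_bound n j : pivot q n j -> (j <= 3 * n)%N.
Proof.
rewrite /pivot; case: ltnP => nq; first by lia.
rewrite /pivot_hi => /or3P[/and5P[]|/and3P[m0 mq /or3P[]/andP[]]|/andP[mq /andP[]]]; lia.
Qed.

(** The last window, 2q + 3m < j < 4q, is already empty when 3m >= 2q - 1. The bounds on [n] and [j]
    make the pivots a finite type. *)
Let pivot_n n j : pivot q n j -> (n < 2 * q)%N.
Proof.
rewrite /pivot; case: ltnP => nq; first by lia.
rewrite /pivot_hi => /or3P[/and5P[/eqP]|/and3P[m0 mq _]|/andP[mq /andP[]]]; lia.
Qed.

Let pivot_j n j : pivot q n j -> (j < 6 * q)%N.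
Proof. by move=> nj; have := pivot_bound nj; have := pivot_n nj; lia. Qed.

Let pivot0 n : pivot q n 0 -> (n < q)%N.
Proof.
rewrite /pivot; case: ltnP => // nq.
rewrite /pivot_hi => /or3P[/and5P[//]|/and3P[m0 mq /or3P[]/andP[]]|/andP[mq /andP[]]]; lia.
Qed.

Let weight_le n j a : (n <= q)%N -> weight q n j a = (a == j)%:Z.
Proof. by rewrite /weight => ->; rewrite subr0. Qed.

Let functional_elem n j n' j' : pivot q n j -> pivot q n' j' ->
  functional n j (elem n' j') = ((n == n') && (j == j'))%:R.
Proof.
move=> nj nj'; rewrite /elem; case: eqP => [j0|/eqP j0].
  have n'q : (n' < q)%N by apply: pivot0; rewrite -j0.
  case: eqP => [n0|/eqP n0].
    have -> : 1 = (1%:P)%:P * bimon 0 0 by rewrite mul1r /bimon mulr1.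
    rewrite functional_mon n0 j0; have [->|nn] := eqVneq n 0%N.
      by rewrite weight_le // mul1r eqxx /= eq_sym.
    by rewrite ifF //; lia.
  rewrite -[ends n']mul1r /ends mulrDr functionalD !functional_mon !mul1r.
  rewrite add0n addn0 j0 eqn_pmul2l // eq_sym.
  have [nn|_] := eqVneq n n'; last by rewrite addr0.
  rewrite nn !(weight_le _ _ (ltnW n'q)).
  (* No functional in this degree reads the coefficient of s^(3n'), so s^(3n') + t^(3n') is detected
     through t^(3n') alone, at a = 0. *)
  have : (j < 3 * n')%N by move: nj; rewrite /pivot nn n'q leq_max ltnS; lia.
  by move=> jn; rewrite gtn_eqF // add0r eq_sym.
rewrite -[bimon _ _]mul1r functional_mon mul1r subnKC ?pivot_bound //.
rewrite eqn_pmul2l // eq_sym; have [nn|//] := eqVneq n n'.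
rewrite nn in nj *; have [nq|nq] := leqP n' q.
  by rewrite weight_le // eq_sym.
have [m m0 nE] : exists2 m, (0 < m)%N & n' = (q + m)%N by exists (n' - q)%N; lia.
rewrite nE in nj nj' *; rewrite !pivotE // in nj nj'.
by rewrite (weight_pivot m0 nj nj') eq_sym.
Qed.

Let T := {p : 'I_(2 * q) * 'I_(6 * q) | pivot q p.1 p.2}.

Let lift_elem n j : pivot q n j -> exists g, param g = elem n j.
Proof.
move=> nj; rewrite /elem; case: eqP => [j0|/eqP j0].
  case: eqP => [_|/eqP n0]; first by exists 1; rewrite rmorph1.
  by apply: param_ends; rewrite lt0n.
have [jn|jn] := ltnP j (3 * n).
  by apply: (param_mon (n := n)); lia.
move: nj; rewrite /pivot; case: ltnP => nq; first by lia.
rewrite /pivot_hi => /or3P[/and5P[]|/and3P[m0 mq /or3P[]/andP[]]|/andP[mq /andP[]]]; lia.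
Qed.

(** Congruence to a combination of pivots is phrased among polynomials in s and t, where the
    relations are between monomials; only the ideal part is lifted to S. *)
Let reduces (u : B) := exists (c : T -> F) w, in_ideal J w /\
  u = param w + \sum_t (c t)%:P%:P * elem (val t).1 (val t).2.

Let reducesP a u v : reduces u -> reduces v -> reduces (a%:P%:P * u + v).
Proof.
move=> [c [w [Jw ->]]] [c' [w' [Jw' ->]]].
exists (fun t => a * c t + c' t), (a *: w + w'); split.
  by apply: in_idealD => //; apply: in_idealZ.
rewrite rmorphD paramZ mulrDr addrACA; congr (_ + _).
rewrite mulr_sumr -big_split; apply: eq_bigr => t _.
by rewrite !polyCD !polyCM mulrDl mulrA.
Qed.

Let reduces_ideal w : in_ideal J w -> reduces (param w).
Proof.
exists (fun=> 0), w; split=> //.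
by rewrite big1 ?addr0 // => t _; rewrite !polyC0 mul0r.
Qed.

Let reduces0 : reduces 0.
Proof. by rewrite -(rmorph0 param); apply/reduces_ideal/in_ideal0. Qed.

Let reducesZ a u : reduces u -> reduces (a%:P%:P * u).
Proof. by move=> /(reducesP a)/(_ reduces0); rewrite addr0. Qed.

Let reducesD u v : reduces u -> reduces v -> reduces (u + v).
Proof. by move=> hu /(reducesP 1 hu); rewrite !polyC1 mul1r. Qed.

(** This turns a two-term relation into a rewriting rule: one term reduces as soon as the other
    does. *)
Let reduces_addl u v : reduces v -> reduces (u + v) -> reduces u.
Proof.
move=> /(reducesP (-1)) h /h; rewrite !polyCN !polyC1 mulN1r addrC.
by rewrite addrK.
Qed.

Let reduces_mulXq i g : reduces (param g * param_coord i ^+ q).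
Proof.
rewrite -paramX -rmorphXn -rmorphM; apply/reduces_ideal/in_idealM/in_ideal_gen.
by rewrite inE; apply/orP; right; apply: image_f.
Qed.

Let reduces_elem n j : pivot q n j -> reduces (elem n j).
Proof.
move=> nj; pose t0 : T := exist _ (Ordinal (pivot_n nj), Ordinal (pivot_j nj)) nj.
exists (fun t => (t == t0)%:R), 0; split; first exact: in_ideal0.
rewrite rmorph0 add0r (bigD1 t0) //= eqxx mul1r big1 ?addr0 // => t /negPf ->.
by rewrite !polyC0 mul0r.
Qed.

Let reduces_eq u v : reduces u -> u = v -> reduces v.
Proof. by move=> hu <-. Qed.

Let mono n j := bimon j (3 * n - j).

(** This and the five facts [mono_y] to [mono_ze] are the relations annihilated by [weight]: x^q,
    y^q or z^q times an interior monomial or [ends m]. *)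
Let mono_x m a : (0 < a < 3 * m)%N -> reduces (mono (q + m) (2 * q + a)).
Proof.
move=> am; have [|||g gE] := param_mon (n := m) (a := a) (b := (3 * m - a)%N); try lia.
apply: reduces_eq (reduces_mulXq ord30 g) _; rewrite param_coordXq /= gE bimonM /mono.
by congr (bimon _ _); lia.
Qed.

Let mono_y m a : (0 < a < 3 * m)%N -> reduces (mono (q + m) (q + a)).
Proof.
move=> am; have [|||g gE] := param_mon (n := m) (a := a) (b := (3 * m - a)%N); try lia.
apply: reduces_eq (reduces_mulXq ord31 g) _; rewrite param_coordXq /= gE bimonM /mono.
by congr (bimon _ _); lia.
Qed.

Let mono_z m a : (0 < a < 3 * m)%N ->
  reduces (mono (q + m) a + mono (q + m) (3 * q + a)).
Proof.
move=> am; have [|||g gE] := param_mon (n := m) (a := a) (b := (3 * m - a)%N); try lia.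
apply: reduces_eq (reduces_mulXq ord32 g) _; rewrite param_coordXq /= gE mulrDr !bimonM addrC /mono.
by congr (bimon _ _ + bimon _ _); lia.
Qed.

Let mono_xe m : (0 < m)%N ->
  reduces (mono (q + m) (2 * q) + mono (q + m) (2 * q + 3 * m)).
Proof.
move=> m0; have [g gE] := param_ends m0.
apply: reduces_eq (reduces_mulXq ord30 g) _; rewrite param_coordXq /= gE mulrDl !bimonM addrC /mono.
by congr (bimon _ _ + bimon _ _); lia.
Qed.

Let mono_ye m : (0 < m)%N ->
  reduces (mono (q + m) q + mono (q + m) (q + 3 * m)).
Proof.
move=> m0; have [g gE] := param_ends m0.
apply: reduces_eq (reduces_mulXq ord31 g) _; rewrite param_coordXq /= gE mulrDl !bimonM addrC /mono.
by congr (bimon _ _ + bimon _ _); lia.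
Qed.

Let mono_ze m : (0 < m)%N -> reduces
  (ends (q + m) + (mono (q + m) (3 * m) + mono (q + m) (3 * q))).
Proof.
move=> m0; have [g gE] := param_ends m0.
apply: reduces_eq (reduces_mulXq ord32 g) _; rewrite param_coordXq /= gE.
rewrite /ends mulrDl !mulrDr !bimonM /mono.
have -> : (3 * (q + m) - 3 * m = 3 * q)%N by lia.
have -> : (3 * (q + m) - 3 * q = 3 * m)%N by lia.
by rewrite !add0n !addn0 !mulnDr [(3 * q + _)%N]addnC; ring.
Qed.

Let reduces_pivot m j : (0 < m)%N -> pivot_hi q m j -> reduces (mono (q + m) j).
Proof.
move=> m0 mj; have := @reduces_elem (q + m) j; rewrite pivotE // => /(_ mj).
rewrite /elem; case: eqP => // j0; move: mj; rewrite -(pivotE q m) j0.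
by move/pivot0; rewrite ltnNge leq_addr.
Qed.

Let reduces_mono_le m j : (0 < m)%N -> (3 * m <= q)%N ->
  (0 < j < 3 * (q + m))%N -> reduces (mono (q + m) j).
Proof.
move=> m0 mq jn.
have hi i : [|| (3 * m <= i < q), (q + 3 * m <= i < 2 * q)
         | (2 * q + 3 * m <= i < 3 * q + 3 * m)]%N -> reduces (mono (q + m) i).
  by move=> ih; apply: reduces_pivot => //; rewrite /pivot_hi m0 mq ih /= orbT.
have h2q : reduces (mono (q + m) (2 * q)).
  by apply: reduces_addl (mono_xe m0); apply: hi; lia.
have [j1|j1] := ltnP j (3 * m).
  by apply: reduces_addl (mono_z (a := j) _); [apply: hi|]; lia.
have [j2|j2] := ltnP j q; first by apply: hi; lia.
have [->|j3] := eqVneq j q.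
  apply: reduces_addl (mono_ye m0).
  (* If 3m = q, the exponent q + 3m is 2q, which is not a pivot but is covered by [h2q]. *)
  have [mq'|mq'] := ltnP (3 * m) q; first by apply: hi; lia.
  by have -> : (q + 3 * m = 2 * q)%N by lia.
have [j4|j4] := ltnP j (q + 3 * m).
  by have := @mono_y m (j - q); rewrite subnKC //; apply; lia.
have [j5|j5] := ltnP j (2 * q); first by apply: hi; lia.
have [->//|j6] := eqVneq j (2 * q)%N.
have [j7|j7] := ltnP j (2 * q + 3 * m).
  by have := @mono_x m (j - 2 * q); rewrite subnKC //; apply; lia.
by apply: hi; lia.
Qed.

Let reduces_mono_gt m j : (0 < m)%N -> (q < 3 * m)%N ->
  (0 < j < 3 * (q + m))%N -> reduces (mono (q + m) j).
Proof.
move=> m0 mq jn.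
(* Since q < 3m, the open windows of y^q and x^q leave no gap between q and 2q + 3m. The relation
   for each end point has its other term inside a window: q + 3m lies in that of x^q, and 2q in that
   of y^q. *)
have mid i : (q <= i <= 2 * q + 3 * m)%N -> reduces (mono (q + m) i).
  move=> /andP[]; rewrite leq_eqVlt => /orP[/eqP <- _|i1].
    apply: reduces_addl (mono_ye m0).
    by have := @mono_x m (3 * m - q); rewrite (_ : 2 * q + _ = q + 3 * m)%N; [apply|]; lia.
  have [i2 _|i2] := ltnP i (q + 3 * m).
    by have := @mono_y m (i - q); rewrite subnKC ?(ltnW i1) //; apply; lia.
  rewrite leq_eqVlt => /orP[/eqP ->|i3].
    apply: (@reduces_addl _ (mono (q + m) (2 * q))); last first.
      by rewrite addrC; apply: mono_xe.
    by have := @mono_y m q; rewrite (_ : q + q = 2 * q)%N; [apply|]; lia.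
  by have := @mono_x m (i - 2 * q); rewrite subnKC; [apply|]; lia.
have hi i : (2 * q + 3 * m < i < 4 * q)%N -> reduces (mono (q + m) i).
  by move=> ih; apply: reduces_pivot => //; rewrite /pivot_hi mq ih /= !orbT.
have [j1|j1] := ltnP j q.
  apply: reduces_addl (mono_z (a := j) _); last by lia.
  by have [?|?] := leqP (3 * q + j) (2 * q + 3 * m); [apply: mid|apply: hi]; lia.
have [j2|j2] := leqP j (2 * q + 3 * m); first by apply: mid; lia.
have [j3|j3] := ltnP j (4 * q); first by apply: hi; lia.
apply: (@reduces_addl _ (mono (q + m) (j - 3 * q))); first by apply: mid; lia.
have := @mono_z m (j - 3 * q); rewrite subnKC; last by lia.
by rewrite addrC; apply; lia.
Qed.

Let reduces_mono n j : (0 < j < 3 * n)%N -> reduces (mono n j).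
Proof.
move=> jn; have jE i : (0 < i)%N -> elem n i = mono n i by rewrite /elem; case: i.
have [nq|nq] := ltnP n q.
  by rewrite -jE; [apply: reduces_elem; rewrite /pivot nq|]; lia.
have [nq'|nq'] := eqVneq n q.
  rewrite nq' in jn jE *.
  have [jq|jq] := eqVneq j q.
    apply: reduces_eq (reduces_mulXq ord31 1) _; rewrite rmorph1 mul1r param_coordXq /= jq /mono.
    by congr (bimon _ _); lia.
  have [jq2|jq2] := eqVneq j (2 * q)%N.
    apply: reduces_eq (reduces_mulXq ord30 1) _; rewrite rmorph1 mul1r param_coordXq /= jq2 /mono.
    by congr (bimon _ _); lia.
  by rewrite -jE; [apply: reduces_elem; rewrite pivot_q|]; lia.
have [m m0 nE] : exists2 m, (0 < m)%N & n = (q + m)%N by exists (n - q)%N; lia.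
rewrite nE in jn *; have [mq|mq] := leqP (3 * m) q; first exact: reduces_mono_le.
exact: reduces_mono_gt.
Qed.

Let reduces_ends n : (0 < n)%N -> reduces (ends n).
Proof.
move=> n0; have [nq|nq] := ltnP n q.
  have := @reduces_elem n 0; rewrite /elem eqxx gtn_eqF //; apply.
  by rewrite /pivot nq; lia.
have [->|nq'] := eqVneq n q.
  by have := reduces_mulXq ord32 1; rewrite rmorph1 mul1r param_coordXq.
have [m m0 ->] : exists2 m, (0 < m)%N & n = (q + m)%N by exists (n - q)%N; lia.
apply: reduces_addl (mono_ze m0).
by apply: reducesD; apply: reduces_mono; lia.
Qed.

Let reduces_span u : curve_span u -> reduces u.
Proof.
elim=> {u}[c|c a b a0 b0 ab|c n n0|u v _ hu _ hv].
- rewrite -[c%:P%:P]mulr1; apply: reducesZ.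
  by apply: (@reduces_elem 0 0); rewrite /pivot q_gt0.
- apply: reducesZ; have := @reduces_mono ((a + b) %/ 3) a; rewrite /mono.
  have -> : (3 * ((a + b) %/ 3) - a = b)%N by lia.
  by apply; lia.
- exact/reducesZ/reduces_ends.
- exact: reducesD.
Qed.

Lemma quot_dim_nodal :
  quot_dim J #|[pred p : 'I_(2 * q) * 'I_(6 * q) | pivot q p.1 p.2]|.
Proof.
have [e eE] := fin_all_exists (fun t : T => lift_elem (valP t)).
rewrite -card_sig.
apply: (quot_dim_dual (e := e)
  (lam := fun t g => functional (val t).1 (val t).2 (param g))).
- by move=> t c g h; rewrite rmorphD /= paramZ functionalP.
- move=> t; apply: in_ideal_ind.
  + by rewrite rmorph0 -[0 in LHS](mul0r 0) -polyC0 -polyC0 functionalZ mul0r.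
  + by move=> g h g0 h0; rewrite rmorphD functionalD g0 h0 addr0.
  move=> g a; rewrite inE => /orP[/eqP ->|/mapP[i _ ->]].
    rewrite rmorphM param_nodal mulr0.
    by rewrite -[0 in LHS](mul0r 0) -polyC0 -polyC0 functionalZ mul0r.
  rewrite rmorphM rmorphXn paramX /=; apply: functional_ideal (valP t) _.
  exact: param_span.
- by move=> t u; rewrite eE functional_elem ?(valP t) ?(valP u).
move=> g; have [c [w [Jw gE]]] := reduces_span (param_span g); exists c.
have sumE : param (\sum_t c t *: e t) =
    \sum_t (c t)%:P%:P * elem (val t).1 (val t).2.
  by rewrite rmorph_sum; apply: eq_bigr => t _; rewrite [LHS]paramZ eE.
(* The congruence found in s and t lifts to S, because the kernel of [param] is generated by
   [nodal], which belongs to [J]. *)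
have [|h hE] := param_ker (g := g - w - \sum_t c t *: e t).
  by rewrite !rmorphB sumE gE [param w + _]addrC addrK subrr.
rewrite -[g - _](subrK w); apply: in_idealD => //.
rewrite addrAC hE mulrC; apply/in_idealM/in_ideal_gen.
by rewrite inE eqxx.
Qed.

End HilbertKunz.
End NodalCurve.

(** * Counting the pivots *)

(** In each degree the pivots form a disjoint union of intervals. Truncated subtraction also gives
    the right value for empty ones. *)
Lemma sum_interval (M a b : nat) : (b <= M)%N ->
  (\sum_(j < M) (a <= j < b) = b - a)%N.
Proof.
move=> bM; rewrite -(big_mkord xpredT (fun j => nat_of_bool (a <= j < b)%N)).
rewrite (eq_bigr (fun j => if (a <= j < b)%N then 1 else 0)%N); last first.
  by move=> j _; case: (_ <= _ < _)%N.
rewrite -big_mkcond /= -big_filter sum1_size.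
have [ab|ba] := leqP a b; last first.
  rewrite (@eq_in_filter _ _ pred0) ?filter_pred0 /=; first by lia.
  by move=> j _ /=; lia.
rewrite -[in RHS](size_iota a (b - a)); congr size.
apply: (irr_sorted_eq ltn_trans ltnn).
- by apply: (sorted_filter ltn_trans); apply: iota_ltn_sorted.
- exact: iota_ltn_sorted.
by move=> j; rewrite mem_filter mem_index_iota mem_iota; lia.
Qed.

Section Count.
Variable q : nat.
Hypothesis q_gt0 : (0 < q)%N.

Definition pivot_count (n : nat) : nat := (\sum_(j < 6 * q) pivot q n j)%N.

Lemma pivot_count_lt n : (n < q)%N -> pivot_count n = maxn 1 (3 * n).
Proof.
move=> nq; rewrite -[RHS]subn0 -(@sum_interval (6 * q)); last by lia.
by apply: eq_bigr => j _; rewrite /pivot nq.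
Qed.

Lemma pivot_count_q : pivot_count q = (3 * q - 3)%N.
Proof.
have -> : (3 * q - 3 = (q - 1) + ((2 * q - q.+1) + (3 * q - (2 * q).+1)))%N by lia.
do 3!(rewrite -[in RHS](@sum_interval (6 * q)); last by lia).
rewrite -!big_split; apply: eq_bigr => j _ /=; rewrite pivot_q.
have [jq|jq|jq] := ltngtP j q; have [jq2|jq2|jq2] := ltngtP j (2 * q); rewrite /= ?andbF ?andbT; lia.
Qed.

Lemma pivot_count_le m : (0 < m)%N -> (3 * m <= q)%N ->
  pivot_count (q + m) = (3 * q - 6 * m)%N.
Proof.
move=> m0 mq.
have -> : (3 * q - 6 * m =
  (q - 3 * m) + ((2 * q - (q + 3 * m)) + (3 * q + 3 * m - (2 * q + 3 * m))))%N by lia.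
do 3!(rewrite -[in RHS](@sum_interval (6 * q)); last by lia).
rewrite -!big_split; apply: eq_bigr => j _ /=.
rewrite pivotE // /pivot_hi m0 mq (gtn_eqF m0) [(q < _)%N]ltnNge mq /= orbF.
lia.
Qed.

Lemma pivot_count_gt m : (0 < m)%N -> (q < 3 * m)%N ->
  pivot_count (q + m) = (2 * q - 1 - 3 * m)%N.
Proof.
move=> m0 mq.
have -> : (2 * q - 1 - 3 * m = 4 * q - (2 * q + 3 * m).+1)%N by lia.
rewrite -(@sum_interval (6 * q)); last by lia.
apply: eq_bigr => j _.
by rewrite pivotE // /pivot_hi [(3 * m <= q)%N]leqNgt mq (gtn_eqF m0) !andbF.
Qed.

Lemma sum_pivot_lt : (2 * \sum_(0 <= n < q) pivot_count n + 3 * q = 2 + 3 * q * q)%N.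
Proof.
rewrite big_nat (eq_bigr (fun n => maxn 1 (3 * n))); last first.
  by move=> n /andP[_ nq]; rewrite pivot_count_lt.
rewrite -big_nat; case: q q_gt0 => // q' _; elim: q' => [|k IH].
  by rewrite big_nat1.
by rewrite big_nat_recr //=; nia.
Qed.

Lemma sum_pivot_le r : (3 * r <= q)%N ->
  (\sum_(1 <= m < r.+1) pivot_count (q + m) + 3 * r * r.+1 = 3 * q * r)%N.
Proof.
elim: r => [|r IH] rq; first by rewrite big_geq //; lia.
rewrite big_nat_recr //= pivot_count_le //.
have := IH (leq_trans _ rq); rewrite leq_pmul2l // leqnSn => /(_ isT); nia.
Qed.

(** As u <= 3, the terms with i >= t are truncated to 0, so the value does not depend on [k].
    Removing the first term lowers both [t] and [k] by one. *)
Lemma sum_truncated_progression t k u : (t <= k)%N -> (u <= 3)%N ->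
  (2 * \sum_(0 <= i < k) (3 * t + u - 3 * i.+1) + 3 * t = 3 * t * t + 2 * t * u)%N.
Proof.
move=> + u3; elim: t k => [|t IH] [|k] // tk.
- by rewrite big_geq.
- by rewrite big1 // => i _; lia.
rewrite big_nat_recl //.
rewrite (eq_bigr (fun i => 3 * t + u - 3 * i.+1))%N; last by move=> i _; lia.
by have := IH k tk; nia.
Qed.

Lemma sum_pivot_gt r t u : (q < 3 * r.+1)%N -> (r < q)%N ->
  (2 * q = 3 * r + 3 * t + u + 1)%N -> (t + r < q)%N -> (u <= 3)%N ->
  (2 * \sum_(r.+1 <= m < q) pivot_count (q + m) + 3 * t = 3 * t * t + 2 * t * u)%N.
Proof.
move=> qr rq E tq u3; rewrite -[r.+1]add0n big_addn.
rewrite -(@sum_truncated_progression t (q - r.+1) u) //; last by lia.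
congr (2 * _ + _)%N; apply: eq_big_nat => i iq.
by rewrite pivot_count_gt; lia.
Qed.

(** Up to lower order terms, the degrees below q contribute 3/2 q^2, those with 3m <= q contribute
    2/3 q^2 and the remaining ones 1/6 q^2, which add up to 7/3 q^2. The equation is cleared of
    fractions and of subtractions. *)
Lemma card_pivot (d := #|[pred p : 'I_(2 * q) * 'I_(6 * q) | pivot q p.1 p.2]|) :
  (3 * d + q + (if q %% 3 == 2 then 5 else 3) = 7 * q * q)%N.
Proof.
have -> : d = (\sum_(0 <= n < q) pivot_count n + pivot_count q +
    \sum_(1 <= m < q) pivot_count (q + m))%N.
  rewrite /d -sum1_card big_mkcond.
  rewrite (eq_bigr (fun p : 'I_(2 * q) * 'I_(6 * q) => nat_of_bool (pivot q p.1 p.2))); last first.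
    by move=> p _; rewrite inE; case: (pivot _ _ _).
  rewrite -(pair_bigA _ (fun (n : 'I_(2 * q)) (j : 'I_(6 * q)) => nat_of_bool (pivot q n j))) /=.
  rewrite -(big_mkord xpredT pivot_count) (big_cat_nat (n := q)) //=; last by lia.
  rewrite -addnA; congr (_ + _)%N.
  rewrite (big_cat_nat (n := q.+1)) //=; last by lia.
  rewrite big_nat1; congr (_ + _)%N.
  rewrite -[q.+1]add1n big_addn (_ : 2 * q - q = q)%N; last by lia.
  by apply: eq_bigr => m _; rewrite addnC.
set r := (q %/ 3)%N.
have rq : (q = 3 * r + q %% 3)%N by rewrite mulnC -divn_eq.
have s3 : (q %% 3 < 3)%N by rewrite ltn_mod.
rewrite pivot_count_q (big_cat_nat (m := 1%N) (n := r.+1)) //=; last by lia.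
have h1 := sum_pivot_lt; have h2 : (3 * r <= q)%N by lia.
have {h2} := sum_pivot_le h2.
(* These [t] and [u] solve 2q - 1 - 3r = 3t + u with 0 <= u < 3, where r is the quotient of q by
   3. *)
have := @sum_pivot_gt r (if q %% 3 == 0 then r - 1 else if q %% 3 == 1 then r else r.+1)%N
  (if q %% 3 == 0 then 2 else if q %% 3 == 1 then 1 else 0)%N.
move: h1 q_gt0; set S1 := bigop _ _ _; set S2 := bigop _ _ _; set S3 := bigop _ _ _.
clearbody r S1 S2 S3.
move: (q %% 3)%N s3 rq => [|[|[|//]]] _ -> /= h1 q0 h3 h2.
- case: r h1 q0 h3 h2 => [|r] h1 q0; first by lia.
  rewrite subSS subn0 => h3; have {h3} : (2 * S2 + 3 * r = 3 * r * r + 2 * r * 2)%N.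
    by apply: h3; lia.
  lia.
- move: h3 => /(_ _ _ _ _ isT) h3; have {h3} : (2 * S2 + 3 * r = 3 * r * r + 2 * r * 1)%N.
    by apply: h3; lia.
  lia.
- have {h3} : (2 * S2 + 3 * r.+1 = 3 * r.+1 * r.+1 + 2 * r.+1 * 0)%N.
    by apply: h3; lia.
  lia.
Qed.

End Count.

(** * Normal form of nodal cubics *)

Lemma homog1_sum n (R : nzRingType) (l : {mpoly R[n]}) : l \is 1.-homog ->
  l = \sum_i l@_U_(i) *: 'X_i.
Proof.
move=> l1; apply/mpolyP => m; rewrite raddf_sum /=.
have [/mdeg_succ[i [m' [-> /eqP]]]|m1] := eqVneq (mdeg m) 1%N.
  rewrite mdeg_eq0 => /eqP ->; rewrite addm0 (bigD1 i) //= mcoeffZ mcoeffX eqxx.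
  rewrite mulr1 big1 ?addr0 // => j ji; rewrite mcoeffZ mcoeffX.
  case: eqP => [/mnmP/(_ i)|]; rewrite ?mulr0 //.
  by rewrite !mnm1E eqxx (negPf ji).
rewrite (dhomog_nemf_coeff l1) // big1 // => i _; rewrite mcoeffZ mcoeffX.
by case: eqP => [mE|]; rewrite ?mulr0 //; rewrite -mE mdeg1 in m1.
Qed.

Section TernaryCubic.
Variable K : fieldType.
Local Notation S := {mpoly K[3]}.
Implicit Types (A B Z g : S).

(** The coefficients are grouped by powers of [Z], so that at [Z = 1] the groups are the components
    of degrees 0 to 3 of a local equation. *)
Definition cubic (c : nat -> K) A B Z : S :=
  (c 0%N)%:MP * Z ^+ 3 + Z ^+ 2 * ((c 1%N)%:MP * A + (c 2%N)%:MP * B)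
  + Z * ((c 3%N)%:MP * A ^+ 2 + (c 4%N)%:MP * A * B + (c 5%N)%:MP * B ^+ 2)
  + ((c 6%N)%:MP * A ^+ 3 + (c 7%N)%:MP * A ^+ 2 * B + (c 8%N)%:MP * A * B ^+ 2
     + (c 9%N)%:MP * B ^+ 3).

Definition lin_comb A B Z g : Prop :=
  exists a b c : K, g = a%:MP * A + b%:MP * B + c%:MP * Z.

Lemma lin_comb_trans A B Z A' B' Z' g :
  lin_comb A' B' Z' A -> lin_comb A' B' Z' B -> lin_comb A' B' Z' Z ->
  lin_comb A B Z g -> lin_comb A' B' Z' g.
Proof.
move=> [a1 [b1 [c1 ->]]] [a2 [b2 [c2 ->]]] [a3 [b3 [c3 ->]]] [a [b [c ->]]].
exists (a * a1 + b * a2 + c * a3), (a * b1 + b * b2 + c * b3),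
  (a * c1 + b * c2 + c * c3); ring.
Qed.

Lemma cubic_expand A B Z F : (forall i, lin_comb A B Z 'X_i) ->
  F \is 3.-homog -> exists c, F = cubic c A B Z.
Proof.
move=> linX /dhomogP hF; rewrite [F]mpolyE big_seq.
elim/big_ind: _ => [|f g [c ->] [c' ->]|m /hF m3].
- by exists (fun=> 0); rewrite /cubic mpolyC0; ring.
- by exists (fun i => c i + c' i); rewrite /cubic; ring.
have [i [m1 [-> /mdeg_succ[j [m2 [-> /mdeg_succ[l [m0 [-> /eqP]]]]]]]]] := mdeg_succ m3.
rewrite mdeg_eq0 => /eqP ->; rewrite !mpolyXD mpolyX0 mulr1 -mul_mpolyC.
move: (_ @__) => t.
have [[a1 [b1 [c1 ->]]] [a2 [b2 [c2 ->]]] [a3 [b3 [c3 ->]]]] :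
  [/\ lin_comb A B Z 'X_i, lin_comb A B Z 'X_j & lin_comb A B Z 'X_l] by [].
(* These are the ten coefficients of the product of the three linear forms that express the factors
   of the monomial. *)
exists (nth 0 [:: t * c1 * c2 * c3;
  t * (a1 * c2 * c3 + a2 * c1 * c3 + a3 * c1 * c2);
  t * (b1 * c2 * c3 + b2 * c1 * c3 + b3 * c1 * c2);
  t * (a1 * a2 * c3 + a1 * a3 * c2 + a2 * a3 * c1);
  t * (a1 * b2 * c3 + b1 * a2 * c3 + a1 * b3 * c2 + b1 * a3 * c2 + a2 * b3 * c1 + b2 * a3 * c1);
  t * (b1 * b2 * c3 + b1 * b3 * c2 + b2 * b3 * c1);
  t * a1 * a2 * a3;
  t * (a1 * a2 * b3 + a1 * b2 * a3 + b1 * a2 * a3);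
  t * (a1 * b2 * b3 + b1 * a2 * b3 + b1 * b2 * a3);
  t * b1 * b2 * b3]).
rewrite /cubic /=; ring.
Qed.

Lemma comp_cubic c A B Z (t : 3.-tuple S) :
  cubic c A B Z \mPo t = cubic c (A \mPo t) (B \mPo t) (Z \mPo t).
Proof.
by rewrite /cubic !(comp_mpolyD, comp_mpolyXn, comp_mpolyM) !comp_mpolyC.
Qed.

End TernaryCubic.

(** Any coordinate may define the chart of the node. Naming the other two here spares the normal
    form a case distinction. *)
Lemma ord3_complete (i : 'I_3) : exists j k, [/\ j != i, k != i, j != k &
  forall (V : nmodType) (G : 'I_3 -> V), \sum_t G t = G j + G k + G i].
Proof.
elim/ord3_ind: i; [exists ord31, ord32|exists ord30, ord32|exists ord30, ord31];
  split=> // V G; rewrite big_ord3 //=.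
- by rewrite -addrA addrC.
- by rewrite addrAC.
Qed.

Section NodalNormalForm.
Variable K : closedFieldType.
Local Notation S := {mpoly K[3]}.

(** A nonzero form has only one degree, so the least degree occurring in the local equation is 2.
    Its components of degrees 0 and 1 therefore vanish, and [l] is the component of degree 2. *)
Lemma initial_form_cubic (c : nat -> K) (j k : 'I_3) (l : S) : j != k ->
  l != 0 -> l \is 2.-homog -> initial_form (cubic c 'X_j 'X_k 1) = l ->
  [/\ c 0%N = 0, c 1%N = 0, c 2%N = 0 &
    l = (c 3%N)%:MP * 'X_j ^+ 2 + (c 4%N)%:MP * 'X_j * 'X_k + (c 5%N)%:MP * 'X_k ^+ 2].
Proof.
move=> jk l0 l2; set g := cubic _ _ _ _ => gl.
have D2 : mdeg (mlast g) = 2%N.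
  by apply: (dhomog_uniq l0) l2; rewrite -gl pihomogP.
have low d : (d < 2)%N -> pihomog mdeg d g = 0.
  move=> d2; rewrite pihomogE big_seq_cond big1 // => m /andP[mg /eqP md].
  by have := lemc_mdeg (mlast_lemc mg); rewrite D2 md leqNgt d2.
have X1 i : ('X_i : S) \is 1.-homog by rewrite dhomogX /= mdeg1.
have X2 i i' : ('X_i * 'X_i' : S) \is 2.-homog.
  by rewrite -[2%N]/(1 + 1)%N; apply: dhomogM.
have CX d b (h : S) : h \is d.-homog -> b%:MP * h \is d.-homog.
  by move=> hh; rewrite mul_mpolyC; apply: rpredZ.
pose h0 : S := (c 0%N)%:MP; pose h1 : S := (c 1%N)%:MP * 'X_j + (c 2%N)%:MP * 'X_k.
pose h2 : S := (c 3%N)%:MP * ('X_j * 'X_j) + (c 4%N)%:MP * ('X_j * 'X_k)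
  + (c 5%N)%:MP * ('X_k * 'X_k).
pose h3 : S := (c 6%N)%:MP * ('X_j * ('X_j * 'X_j)) + (c 7%N)%:MP * ('X_j * ('X_j * 'X_k))
  + (c 8%N)%:MP * ('X_j * ('X_k * 'X_k)) + (c 9%N)%:MP * ('X_k * ('X_k * 'X_k)).
have gE : g = h0 + h1 + h2 + h3 by rewrite /g /cubic /h0 /h1 /h2 /h3; ring.
have H0 : h0 \is 0.-homog.
  by rewrite /h0 -[(c 0%N)%:MP]mulr1; apply: CX; apply: dhomog1.
have H1 : h1 \is 1.-homog by rewrite rpredD // CX.
have H2 : h2 \is 2.-homog by rewrite !rpredD // CX.
have H3 : h3 \is 3.-homog.
  by rewrite !rpredD // CX // -[3%N]/(1 + 2)%N dhomogM.
have piE d : pihomog mdeg d g = (if d == 0%N then h0 else 0) + (if d == 1%N then h1 else 0)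
    + (if d == 2%N then h2 else 0) + (if d == 3%N then h3 else 0).
  have pi1 d' (h : S) : h \is d'.-homog -> pihomog mdeg d h = (if d == d' then h else 0).
    move=> hh; have [->|dd] := eqVneq d d'; first exact: pihomog_dE.
    by rewrite (pihomog_ne0 _ hh) // eq_sym.
  by rewrite gE 3!pihomogD (pi1 _ _ H0) (pi1 _ _ H1) (pi1 _ _ H2) (pi1 _ _ H3).
have := low 0%N isT; rewrite piE /= !addr0 => /eqP.
rewrite mpolyC_eq0 => /eqP c0.
have := low 1%N isT; rewrite piE /= !addr0 add0r => h10.
have h1v (v : 'I_3 -> K) : c 1%N * v j + c 2%N * v k = 0.
  have := congr1 (meval v) h10.
  by rewrite /h1 !(rmorphD, rmorphM, rmorph0) /= !mevalC !mevalXU.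
split=> //.
- by have := h1v (fun i => (i == j)%:R); rewrite eqxx eq_sym (negPf jk) mulr0 addr0 mulr1.
- by have := h1v (fun i => (i == k)%:R); rewrite eqxx (negPf jk) mulr0 add0r mulr1.
rewrite -gl /initial_form D2 piE /= addr0 !add0r /h2; ring.
Qed.

(** A priori the factors may involve [X_i]. If one did, comparing the product at [X_i = 1] and
    [X_i = 0] would force the other factor to be 0. The coefficients are then read off at points
    with coordinates 0 and 1. *)
Lemma split_quadratic (c3 c4 c5 : K) (i j k : 'I_3) (l1 l2 : S) :
  j != i -> k != i -> j != k ->
  (forall (V : nmodType) (G : 'I_3 -> V), \sum_t G t = G j + G k + G i) ->
  l1 \is 1.-homog -> l2 \is 1.-homog ->
  (forall a b : K, a *: l1 + b *: l2 = 0 -> a = 0 /\ b = 0) ->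
  l1 * l2 = c3%:MP * 'X_j ^+ 2 + c4%:MP * 'X_j * 'X_k + c5%:MP * 'X_k ^+ 2 ->
  exists a1 b1 a2 b2 : K, [/\ a1 * b2 - a2 * b1 != 0, c3 = a1 * a2,
    c4 = a1 * b2 + a2 * b1 & c5 = b1 * b2].
Proof.
move=> ji ki jk sum3 /homog1_sum l1E /homog1_sum l2E free E.
move: l1E l2E; rewrite !sum3.
move: (l1@_ _) (l1@_ _) (l1@_ _) (l2@_ _) (l2@_ _) (l2@_ _).
move=> d1 b1 a1 d2 b2 a2 l1E l2E.
have Ev s t r : (a1 * s + b1 * t + d1 * r) * (a2 * s + b2 * t + d2 * r) =
    c3 * s ^+ 2 + c4 * s * t + c5 * t ^+ 2.
  pose v l := if l == j then s else if l == k then t else r.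
  have [vj vk vi] : [/\ v j = s, v k = t & v i = r].
    by rewrite /v eqxx [k == j]eq_sym (negPf jk) eqxx ![i == _]eq_sym (negPf ji) (negPf ki).
  have := congr1 (meval v) E; rewrite l1E l2E -!mul_mpolyC.
  rewrite rmorphM !rmorphD !rmorphM /= !mevalC !mevalXU.
  by rewrite vi vj vk !expr2 => ->.
have lin s t : d1 * (a2 * s + b2 * t) + d2 * (a1 * s + b1 * t) + d1 * d2 = 0.
  have := Ev s t 1; rewrite -(Ev s t 0) => /eqP; rewrite -subr_eq0 => /eqP <-; ring.
have dd : d1 * d2 = 0 by have := lin 0 0; rewrite !mulr0 !addr0 !mulr0 !add0r.
have l10 : l1 != 0.
  apply/eqP => l10; have [] := free 1 0; last by move/eqP; rewrite oner_eq0.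
  by rewrite l10 scaler0 scale0r addr0.
have l20 : l2 != 0.
  apply/eqP => l20; have [] := free 0 1; last by move=> _ /eqP; rewrite oner_eq0.
  by rewrite l20 scaler0 scale0r addr0.
have [d10 d20] : d1 = 0 /\ d2 = 0.
  have sv (d a : K) : d != 0 -> d * a = 0 -> a = 0.
    by move=> d0 /eqP; rewrite mulf_eq0 (negPf d0) => /eqP.
  have s10 := lin 1 0; have s01 := lin 0 1.
  have [d10|d10] := eqVneq d1 0.
    have [//|d20] := eqVneq d2 0; case/eqP: l10; rewrite l1E d10.
    have -> : a1 = 0 by apply: (sv d2) => //; rewrite -s10 d10; ring.
    have -> : b1 = 0 by apply: (sv d2) => //; rewrite -s01 d10; ring.
    by rewrite !scale0r !addr0.
  have d20 := sv _ _ d10 dd; case/eqP: l20; rewrite l2E d20.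
  have -> : a2 = 0 by apply: (sv d1) => //; rewrite -s10 d20; ring.
  have -> : b2 = 0 by apply: (sv d1) => //; rewrite -s01 d20; ring.
  by rewrite !scale0r !addr0.
exists a1, b1, a2, b2.
have c3E : c3 = a1 * a2.
  transitivity (c3 * 1 ^+ 2 + c4 * 1 * 0 + c5 * 0 ^+ 2); [|rewrite -(Ev _ _ 0)]; ring.
have c5E : c5 = b1 * b2.
  transitivity (c3 * 0 ^+ 2 + c4 * 0 * 1 + c5 * 1 ^+ 2); [|rewrite -(Ev _ _ 0)]; ring.
have c4E : c4 = a1 * b2 + a2 * b1.
  transitivity (c3 * 1 ^+ 2 + c4 * 1 * 1 + c5 * 1 ^+ 2 - c3 - c5).
    by ring.
  by rewrite -(Ev 1 1 0) c3E c5E; ring.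
split=> //.
  (* With zero determinant, b2 l1 - b1 l2 = 0 gives b1 = b2 = 0; then a2 l1 - a1 l2 = 0 gives a2 =
     0, and [l2] would be 0. *)
  apply/eqP => det0.
  have := free b2 (- b1); rewrite l1E l2E d10 d20 !scale0r !addr0 !scalerDr !scalerA.
  rewrite addrACA -!scalerDl !mulNr [b2 * b1]mulrC subrr scale0r addr0.
  rewrite [b2 * a1]mulrC [b1 * a2]mulrC det0 scale0r => /(_ erefl)[b20 /eqP].
  rewrite oppr_eq0 => /eqP b10.
  have := free a2 (- a1); rewrite l1E l2E d10 d20 b20 b10 !scale0r !addr0 !scalerA.
  rewrite -scalerDl mulNr mulrC subrr scale0r => /(_ erefl)[a20 _].
  by case/eqP: l20; rewrite l2E a20 b20 d20 !scale0r !addr0.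
Qed.

Lemma cube_root (c : K) : exists a, a ^+ 3 = c.
Proof.
have /closed_rootP[a /rootP] : size ('X^3 - c%:P : {poly K}) != 1%N.
  by rewrite size_XnsubC.
by rewrite !hornerE => /eqP; rewrite subr_eq0 => /eqP <-; exists a.
Qed.

Lemma vanish0_nonunit (g : S) : g.@[fun=> 0] = 0 -> g \isn't a GRing.unit.
Proof.
move=> g0; apply/negP => /mulrV /(congr1 (meval (fun=> 0))).
by rewrite rmorphM /= g0 mul0r rmorph1 => /eqP; rewrite eq_sym oner_eq0.
Qed.

(** Writing the variables in terms of [A], [B], [Z] yields a one-sided inverse of their coefficient
    matrix, and for square matrices this suffices. *)
Lemma lin_comb_subst (A B Z : S) : A \is 1.-homog -> B \is 1.-homog ->
  Z \is 1.-homog -> (forall i, lin_comb A B Z 'X_i) ->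
  exists2 M : 'M[K]_3, M \in unitmx & lin_subst M = [tuple A; B; Z].
Proof.
move=> A1 B1 Z1 span; set L := [tuple A; B; Z].
have L1 i : tnth L i \is 1.-homog.
  by elim/ord3_ind: i; rewrite (tnth_nth 0).
pose M : 'M[K]_3 := \matrix_(i, j) (tnth L i)@_U_(j).
have ML i : \sum_j M i j *: 'X_j = tnth L i.
  by rewrite [RHS]homog1_sum //; apply: eq_bigr => j _; rewrite mxE.
have [N NE] : exists N : 'M[K]_3, forall i, 'X_i = \sum_j N i j *: tnth L j.
  have [a aE] := fin_all_exists span; have [b bE] := fin_all_exists aE.
  have [c cE] := fin_all_exists bE.
  exists (\matrix_(i, j) [:: a i; b i; c i]`_j) => i.
  by rewrite big_ord3 /= !mxE !(tnth_nth 0) /= -!mul_mpolyC.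
exists M; last first.
  by apply: eq_from_tnth => i; rewrite tnth_mktuple ML.
have: N *m M = 1%:M.
  apply/matrixP => i j; rewrite !mxE.
  have := congr1 (mcoeff U_(j)) (NE i); rewrite mcoeffXU => ->.
  rewrite raddf_sum; apply: eq_bigr => l _ /=; rewrite mcoeffZ.
  by rewrite [M _ _]mxE.
by case/mulmx1_unit.
Qed.

Lemma nodal_normal_form (F : S) P : F \is 3.-homog -> irreducible_elt F ->
  node F P -> exists2 M : 'M[K]_3, M \in unitmx & F = nodal K \mPo lin_subst M.
Proof.
move=> F3 [F0 _ Firr] [i Pi0 [l1 [l2 [l11 l21 free gl]]]].
have [j [k [ji ki jk sum3]]] := ord3_complete i.
have CX b (h : S) : h \is 1.-homog -> b%:MP * h \is 1.-homog.
  by move=> hh; rewrite mul_mpolyC; apply: rpredZ.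
have X1 t : ('X_t : S) \is 1.-homog by rewrite dhomogX /= mdeg1.
pose u t := P t / P i; pose Z : S := 'X_i.
(* Two lines through [P]; passing to the local equation replaces [A0], [B0], [Z] by [X_j], [X_k],
   1. *)
pose A0 : S := 'X_j - (u j)%:MP * Z; pose B0 : S := 'X_k - (u k)%:MP * Z.
have all3 t : [\/ t = i, t = j | t = k].
  have := sum3 nat (fun s => nat_of_bool (s == t)).
  rewrite (bigD1 t) //= eqxx big1 => [|s /negPf ->] //.
  by have [->|] := eqVneq j t; have [->|] := eqVneq k t; have [->|] := eqVneq i t;
    [constructor..| ].
have span0 t : lin_comb A0 B0 Z 'X_t.
  case: (all3 t) => ->.
  - by exists 0, 0, 1; rewrite mpolyC0 mpolyC1 /Z; ring.
  - by exists 1, 0, (u j); rewrite mpolyC0 mpolyC1 /A0; ring.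
  - by exists 0, 1, (u k); rewrite mpolyC0 mpolyC1 /B0; ring.
have [c cE] := cubic_expand span0 F3.
have locE : local_equation F P i = cubic c 'X_j 'X_k 1.
  rewrite /local_equation cE comp_cubic !comp_mpolyB !comp_mpolyM !comp_mpolyC.
  rewrite !comp_mpolyXU -!tnth_nth !tnth_mktuple eqxx (negPf ji) (negPf ki).
  by rewrite !mulr1 !addrK.
rewrite locE in gl.
have l10 : l1 != 0.
  apply/eqP => l10; have [] := free 1 0; last by move/eqP; rewrite oner_eq0.
  by rewrite l10 scaler0 scale0r addr0.
have l20 : l2 != 0.
  apply/eqP => l20; have [] := free 0 1; last by move=> _ /eqP; rewrite oner_eq0.
  by rewrite l20 scaler0 scale0r addr0.
have [c0 c1 c2 l12] := initial_form_cubic jk (mulf_neq0 l10 l20) (dhomogM l11 l21) gl.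
have [a1 [b1 [a2 [b2 [det c3 c4 c5]]]]] :=
  split_quadratic ji ki jk sum3 l11 l21 free l12.
(* [A] and [B] are the tangents at the node; Cramer's rule expresses [A0] and [B0] through them. *)
pose A := a1%:MP * A0 + b1%:MP * B0; pose B := a2%:MP * A0 + b2%:MP * B0.
pose D := (a1 * b2 - a2 * b1)^-1.
pose r1 := D * b2; pose r2 := - D * b1; pose s1 := - D * a2; pose s2 := D * a1.
have DV : D * (a1 * b2 - a2 * b1) = 1 by rewrite mulVf.
have A0E : A0 = r1%:MP * A + r2%:MP * B.
  rewrite -[LHS]mul1r -mpolyC1 -DV /A /B /r1 /r2; ring.
have B0E : B0 = s1%:MP * A + s2%:MP * B.
  rewrite -[LHS]mul1r -mpolyC1 -DV /A /B /s1 /s2; ring.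
have [al [be [ga [de FE]]]] : exists al be ga de : K, F = A * B * Z
   + (al%:MP * A ^+ 3 + be%:MP * A ^+ 2 * B + ga%:MP * A * B ^+ 2 + de%:MP * B ^+ 3).
  exists (c 6%N * r1 ^+ 3 + c 7%N * r1 ^+ 2 * s1 + c 8%N * r1 * s1 ^+ 2 + c 9%N * s1 ^+ 3).
  exists (c 6%N * (3%:R * r1 ^+ 2 * r2) + c 7%N * (r1 ^+ 2 * s2 + 2%:R * r1 * r2 * s1)
     + c 8%N * (2%:R * r1 * s1 * s2 + r2 * s1 ^+ 2) + c 9%N * (3%:R * s1 ^+ 2 * s2)).
  exists (c 6%N * (3%:R * r1 * r2 ^+ 2) + c 7%N * (r2 ^+ 2 * s1 + 2%:R * r1 * r2 * s2)
     + c 8%N * (2%:R * r2 * s1 * s2 + r1 * s2 ^+ 2) + c 9%N * (3%:R * s1 * s2 ^+ 2)).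
  exists (c 6%N * r2 ^+ 3 + c 7%N * r2 ^+ 2 * s2 + c 8%N * r2 * s2 ^+ 2 + c 9%N * s2 ^+ 3).
  transitivity (A * B * Z + ((c 6%N)%:MP * A0 ^+ 3 + (c 7%N)%:MP * A0 ^+ 2 * B0
      + (c 8%N)%:MP * A0 * B0 ^+ 2 + (c 9%N)%:MP * B0 ^+ 3)).
    by rewrite {1}cE /cubic c0 c1 c2 c3 c4 c5 mpolyC0 /A /B; ring.
  rewrite {1 2 3}A0E {1 2 3}B0E; ring.
have A01 : A0 \is 1.-homog by apply: rpredB; [exact: X1 | exact/CX/X1].
have B01 : B0 \is 1.-homog by apply: rpredB; [exact: X1 | exact/CX/X1].
have A1 : A \is 1.-homog by apply: rpredD; exact: CX.
have B1 : B \is 1.-homog by apply: rpredD; exact: CX.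
have hom1_0 (g : S) : g \is 1.-homog -> g.@[fun=> 0] = 0.
  move/homog1_sum ->; rewrite raddf_sum big1 // => t _.
  by rewrite /= mevalZ mevalXU mulr0.
(* If [al] were 0, the tangent [B] would divide the irreducible cubic; likewise [A] if [de] were
   0. *)
have al0 : al != 0.
  apply/eqP => al0; have [] := Firr B (A * Z + be%:MP * A ^+ 2 + ga%:MP * A * B + de%:MP * B ^+ 2).
  - by rewrite FE al0 mpolyC0; ring.
  - exact/negP/vanish0_nonunit/hom1_0.
  - apply/negP/vanish0_nonunit; rewrite !rmorphD !rmorphM /= (hom1_0 A A1) (hom1_0 B B1); ring.
have de0 : de != 0.
  apply/eqP => de0; have [] := Firr A (B * Z + al%:MP * A ^+ 2 + be%:MP * A * B + ga%:MP * B ^+ 2).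
  - by rewrite FE de0 mpolyC0; ring.
  - exact/negP/vanish0_nonunit/hom1_0.
  - apply/negP/vanish0_nonunit; rewrite !rmorphD !rmorphM /= (hom1_0 A A1) (hom1_0 B B1); ring.
(* The signs match the terms - x^3 - y^3 of [nodal]. *)
have [a aE] := cube_root (- al); have [b bE] := cube_root (- de).
have a0 : a != 0 by apply: contra_neq al0 => a0; rewrite -[al]opprK -aE a0 expr0n oppr0.
have b0 : b != 0 by apply: contra_neq de0 => b0; rewrite -[de]opprK -bE b0 expr0n oppr0.
pose A' := a%:MP * A; pose B' := b%:MP * B.
(* The mixed terms disappear because A B Z + be A^2 B + ga A B^2 = A B (Z + be A + ga B), and the
   scalar makes A' B' Z' equal to this product. *)
pose Z' := (a^-1 * b^-1)%:MP * (Z + be%:MP * A + ga%:MP * B).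
have aV : a * a^-1 = 1 by rewrite mulfV.
have bV : b * b^-1 = 1 by rewrite mulfV.
have spanA : lin_comb A' B' Z' A.
  exists a^-1, 0, 0; rewrite mpolyC0 /A' [a^-1%:MP * _]mulrA -mpolyCM.
  by rewrite [a^-1 * a]mulrC aV mpolyC1; ring.
have spanB : lin_comb A' B' Z' B.
  exists 0, b^-1, 0; rewrite mpolyC0 /B' [b^-1%:MP * _]mulrA -mpolyCM.
  by rewrite [b^-1 * b]mulrC bV mpolyC1; ring.
have spanZ : lin_comb A' B' Z' Z.
  exists (- be * a^-1), (- ga * b^-1), (a * b).
  transitivity ((- be * (a * a^-1))%:MP * A + (- ga * (b * b^-1))%:MP * B
    + ((a * a^-1) * (b * b^-1))%:MP * (Z + be%:MP * A + ga%:MP * B)).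
    by rewrite aV bV !mulr1 mpolyC1; ring.
  by rewrite /A' /B' /Z'; ring.
have Z1 : Z' \is 1.-homog.
  by apply/CX/rpredD; [apply: rpredD; [exact: X1|]|]; exact: CX.
have [|M uM ME] := lin_comb_subst (CX a A A1) (CX b B B1) Z1.
  move=> t; apply: lin_comb_trans (span0 t) => //.
  - apply: (@lin_comb_trans _ A B Z) => //.
    by exists r1, r2, 0; rewrite mpolyC0 mul0r addr0.
  - apply: (@lin_comb_trans _ A B Z) => //.
    by exists s1, s2, 0; rewrite mpolyC0 mul0r addr0.
exists M => //; rewrite /nodal ME !comp_mpolyB !comp_mpolyXn !comp_mpolyM.
rewrite !comp_mpolyXU /=.
transitivity ((a * a^-1 * (b * b^-1))%:MP * (A * B * (Z + be%:MP * A + ga%:MP * B))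
   - (a ^+ 3)%:MP * A ^+ 3 - (b ^+ 3)%:MP * B ^+ 3).
  by rewrite aV bV mulr1 mpolyC1 aE bE FE; ring.
by rewrite /Z'; ring.
Qed.

End NodalNormalForm.

(** * Descent to the base field and conclusion *)

Lemma map_mpoly_dhomog (k K : fieldType) (iota : {rmorphism k -> K}) n d
    (f : {mpoly k[n]}) : f \is d.-homog -> map_mpoly iota f \is d.-homog.
Proof.
move=> /dhomogP fd; apply/dhomogP => m; rewrite mcoeff_msupp mcoeff_map_mpoly.
by rewrite fmorph_eq0 -mcoeff_msupp; apply: fd.
Qed.

Unset Implicit Arguments.

Theorem theorem3 (p : nat) (k : fieldType) (charkp : p \in [pchar k])
    (K : closedFieldType) (iota : {rmorphism k -> K})
    (Kclosure : algebraic_closure iota)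
    (f : {mpoly k[3]}) (f_nodal : nodal_cubic iota f)
    (q e : nat) (q_pow : q = (p ^ e)%N) :
  exists2 d : nat, HK f q d &
    d%:R = (if (q %% 3 != 2)%N
            then 7 / 3 * q%:R ^+ 2 - 1 / 3 * q%:R - 1
            else 7 / 3 * q%:R ^+ 2 - 1 / 3 * q%:R - 5 / 3) :> rat.
Proof.
have [f3 [F_irr [P [_ _ P_node]]]] := f_nodal.
have charKp := rmorph_pchar iota charkp.
have q_gt0 : (0 < q)%N by rewrite q_pow expn_gt0 prime_gt0 // (pcharf_prime charkp).
have [M uM FE] := nodal_normal_form (map_mpoly_dhomog iota f3) F_irr P_node.
have frob : (bimon K 3 0 + bimon K 0 3) ^+ q = ends K q.
  have charB : p \in [pchar {poly {poly K}}].
    by apply: (rmorph_pchar polyC); apply: (rmorph_pchar polyC).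
  by rewrite q_pow exprDn_pchar ?pchar_nat_exp // !bimonX !mul0n.
exists #|[pred p : 'I_(2 * q) * 'I_(6 * q) | pivot q p.1 p.2]|.
  apply: (quot_dim_map (iota := iota)); rewrite FE q_pow.
  by apply: quot_dim_lin_subst => //; rewrite -q_pow; apply: quot_dim_nodal.
have := card_pivot q_gt0; set d := #|_|; move/(congr1 (fun m => m%:R : rat)).
rewrite 2!natrD !natrM => dE.
have -> : d%:R = ((3 * d%:R + q%:R + (if (q %% 3 == 2)%N then 5 else 3)%:R)
    - q%:R - (if (q %% 3 == 2)%N then 5 else 3)%:R) / 3 :> rat by field.
by rewrite dE; case: (q %% 3 == 2)%N; field.
Qed.
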